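(* Let $\mathcal{N}(t)$, $t>0$, be a nonlinear pure birth process with pairwise distinct birth rates $\lambda_k>0$, $k\ge1$, and $\mathcal{N}(0)=1$. For $t>0$ let $\mathfrak{G}_t=\int_0^tI_{[0,\infty)}(\bar B(s))\,ds$, where $\bar B$ is a Brownian bridge on $[0,t]$ (from $0$ to $0$) independent of $\mathcal{N}$. Then $$\Pr\{\mathcal{N}(\mathfrak{G}_t)=k\}=\begin{cases}\displaystyle\frac1{\lambda_kt}\left\{1-\sum_{m=1}^k\ \prod_{l=1,l\neq m}^k\left(\frac{\lambda_l}{\lambda_l-\lambda_m}\right)e^{-\lambda_mt}\right\},&k>1,\\[2mm]\displaystyle\frac{1-e^{-\lambda_1t}}{\lambda_1t},&k=1.\end{cases}$$
   Context: The nonlinear pure birth process $\mathcal{N}(t)$ with rates $(\lambda_k)_{k\ge1}$ is the continuous-time Markov chain on $\{1,2,\dots\}$ started at $1$ which from state $k$ jumps only to $k+1$, at rate $\lambda_k$; it is assumed throughout that $\sum_k1/\lambda_k=\infty$ (no explosion). *)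

(* Defs.v *)
(* MathComp-Analysis, over an arbitrary R : realType. *)
From HB Require Import structures.
From mathcomp Require Import all_boot all_order all_algebra.
From mathcomp Require Import all_classical all_reals all_analysis.
Set Implicit Arguments.
Unset Strict Implicit.
Unset Printing Implicit Defensive.
Import Order.TTheory GRing.Theory Num.Theory.
Import numFieldNormedType.Exports.
Local Open Scope classical_set_scope.
Local Open Scope ring_scope.

Section Processes.
Context {R : realType} {d : measure_display} {Omega : measurableType d}.
Variable P : probability Omega R.

(* The sigma-algebra sigma(X r, r in D). *)
Definition process_sigma {d'} {S : measurableType d'}
    (D : set R) (X : R -> {RV P >-> S}) : set (set Omega) :=
  <<s \bigcup_(r in D) preimage_set_system [set: Omega] (X r) measurable >>.

Definition independent_processes {d1 d2} {S1 : measurableType d1}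
    {S2 : measurableType d2} (D1 : set R) (X : R -> {RV P >-> S1})
    (D2 : set R) (Y : R -> {RV P >-> S2}) : Prop :=
  forall A1 A2 : set Omega, process_sigma D1 X A1 -> process_sigma D2 Y A2 ->
  P (A1 `&` A2) = (P A1 * P A2)%E.

(* [p h i j] is the probability of going from i to j in time h.  The states are
   the positive integers; the state 0 of nat is not used. *)
Definition markov_with_transition (N : R -> {RV P >-> nat})
    (p : R -> nat -> nat -> R) : Prop :=
  forall (s h : R) (i j : nat) (A : set Omega),
    0 <= s -> 0 <= h -> (0 < i)%N -> (0 < j)%N ->
    process_sigma `[0, s] N A ->
    P (A `&` [set w | N s w = i] `&` [set w | N (s + h) w = j]) =
    ((p h i j)%:E * P (A `&` [set w | N s w = i]))%E.

(* Time-homogeneous Markov chain whose jump rates are the off-diagonal entries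
   of Q, i.e. p h i j = (i == j) + Q i j * h + o(h) as h -> 0+. *)
Definition markov_chain_with_rates (N : R -> {RV P >-> nat})
    (Q : nat -> nat -> R) : Prop :=
  exists p : R -> nat -> nat -> R,
    markov_with_transition N p /\
    forall i j : nat, (0 < i)%N -> (0 < j)%N ->
      (p h i j - (i == j)%:R) / h @[h --> 0^'+] --> Q i j.

Definition birth_rates (lambda : nat -> R) (i j : nat) : R :=
  if j == i.+1 then lambda i else if j == i then - lambda i else 0.

Record pure_birth_process (lambda : nat -> R) (N : R -> {RV P >-> nat}) : Prop := {
  birth_start : forall w, N 0 w = 1%N;
  birth_nondecreasing : forall w (s u : R), 0 <= s -> s <= u ->
    (N s w <= N u w)%N;
  (* right-continuity of the paths, nat being discrete *)
  birth_right_continuous : forall w (s : R), 0 <= s ->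
    \forall u \near s^'+, N u w = N s w;
  birth_markov : markov_chain_with_rates N (birth_rates lambda)
}.

(* The normal law with mean m and *variance* v.  The case v = 0 is separate
   because [normal_prob m 0] is the uniform law on [0, 1]. *)
Definition normal_law (m v : R) (A : set R) : \bar R :=
  if v == 0 then \d_m A else normal_prob m (Num.sqrt v) A.

(* Gaussian process on D with mean function m and covariance function C. *)
Definition gaussian_process (D : set R) (X : R -> {RV P >-> R})
    (m : R -> R) (C : R -> R -> R) : Prop :=
  forall (n : nat) (s a : 'I_n -> R) (A : set R),
    (forall i, D (s i)) -> measurable A ->
    P [set w | A (\sum_(i < n) a i * X (s i) w)] =
    normal_law (\sum_(i < n) a i * m (s i))
      (\sum_(i < n) \sum_(j < n) a i * a j * C (s i) (s j)) A.

(* The covariance vanishes at the endpoints, so the bridge goes from 0 to 0. *)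
Record brownian_bridge (t : R) (B : R -> {RV P >-> R}) : Prop := {
  bridge_gaussian : gaussian_process `[0, t] B (fun=> 0)
    (fun s u => Num.min s u - s * u / t);
  bridge_continuous : forall w, {within `[0, t], continuous (fun s : R => B s w)}
}.

Definition sojourn_time (t : R) (B : R -> {RV P >-> R}) (w : Omega) : R :=
  \int[lebesgue_measure]_(s in `[0, t]) \1_(`[0, +oo[ : set R) (B s w).

End Processes.

(* Main.v *)
(* Two facts are combined.

   Birth process.  With F_k(s) = Pr{N(s) <= k} and p_k(s) = Pr{N(s) = k}, the
   Markov property and the rates give F_k' = - lambda_k p_k; hence
   A_k = - sum_(j <= k) F_j / lambda_j is a primitive of F_k, and F_k is the
   closed-form sum of exponentials of the statement by uniqueness for the linear
   ODE (the value 1 at s = 0 is Lagrange interpolation of the constant 1).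

   Bridge.  The sojourn time is uniform on [0, t].  Sampled at the n times j t / n,
   the bridge has the same law as each of its cyclic shifts B(s + r) - B(r), for
   which the number of positive samples is the rank of B(r) among the samples.
   Averaging over the n shifts, the number C of positive samples is uniform on
   {0, ..., n - 1}; and t C / n tends to the sojourn time in probability.

   As N is nondecreasing and independent of C, N(sojourn time) is squeezed between
   the N((C -+ q) t / n), whose laws are Riemann sums of F_k.  So
   Pr{N(sojourn time) <= k} = (A_k(t) - A_k(0)) / t, and the difference of these
   values at k and k - 1 is (1 - F_k(t)) / (lambda_k t). *)
Require Import Defs.
From HB Require Import structures.
From mathcomp Require Import all_boot all_order all_algebra.
From mathcomp Require Import all_classical all_reals all_analysis.
From mathcomp Require Import measurable_realfun.
From mathcomp Require Import ring lra zify.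
Set Implicit Arguments.
Unset Strict Implicit.
Unset Printing Implicit Defensive.
Import Order.TTheory GRing.Theory Num.Theory.
Import numFieldNormedType.Exports.
Local Open Scope classical_set_scope.
Local Open Scope ring_scope.

(** * Linear differential equations and the hypoexponential law *)

(** The Lagrange basis polynomials at the nodes [x 1], ..., [x k] sum to 1: their sum minus 1 has
    size at most [k] and vanishes at [k] distinct nodes. The identity is the value at 0. *)
Lemma sum_lagrange_basis_at0 (F : fieldType) (k : nat) (x : nat -> F) :
  (0 < k)%N ->
  (forall i j, (1 <= i)%N -> (1 <= j)%N -> i <> j -> x i <> x j) ->
  \sum_(1 <= m < k.+1) \prod_(1 <= l < k.+1 | l != m) (x l / (x l - x m)) = 1.
Proof.
move=> k0 x_inj.
have x_neq i j : (1 <= i)%N -> (1 <= j)%N -> i != j -> x i - x j != 0.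
  move=> i0 j0 /eqP ij; rewrite subr_eq0; apply/eqP; exact: x_inj.
pose fac m l : {poly F} := (x l - x m)^-1 *: ((x l)%:P - 'X).
pose L m : {poly F} := \prod_(1 <= l < k.+1 | l != m) fac m l.
pose p : {poly F} := \sum_(1 <= m < k.+1) L m - 1.
have Lx m i : (1 <= i)%N -> (i < k.+1)%N -> (1 <= m)%N -> (m < k.+1)%N ->
    (L m).[x i] = (i == m)%:R.
  move=> i0 ik m0 mk; rewrite /L horner_prod; case: (eqVneq i m) => [->|im].
    rewrite big_nat_cond big1// => l /andP[/andP[l0 _] lm].
    by rewrite !hornerE mulVf// x_neq.
  rewrite big_mkcond (bigD1_seq i) ?mem_index_iota ?i0 ?iota_uniq//= im.
  by rewrite !hornerE subrr mulr0 mul0r.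
have p0 : p = 0.
  apply: (@roots_geq_poly_eq0 _ _ (map x (index_iota 1 k.+1))).
  - apply/allP => _ /mapP[i + ->]; rewrite mem_index_iota => /andP[i0 ik].
    rewrite /root /p !hornerE horner_sum (bigD1_seq i) ?mem_index_iota ?i0 ?iota_uniq//=.
    rewrite big_nat_cond big1 ?addr0 ?Lx// ?eqxx ?subrr//.
    move=> m /andP[/andP[m0 mk] mi]; rewrite Lx//.
    by rewrite eq_sym (negbTE mi).
  - rewrite map_inj_in_uniq ?iota_uniq// => i j.
    rewrite !mem_index_iota => /andP[i0 _] /andP[j0 _] xij.
    by apply/eqP/negPn/negP => /eqP ij; exact: (x_inj i j).
  - rewrite size_map size_iota subn1 /=.
    rewrite (leq_trans (size_polyD _ _))// geq_max size_polyN size_poly1 k0 andbT.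
    rewrite (leq_trans (size_sum _ _ _))//; apply/bigmax_leqP_seq => m.
    rewrite mem_index_iota => /andP[m0 mk] _.
    have szL (r : seq nat) : (size (\prod_(l <- r) fac m l)%R <= (size r).+1)%N.
      elim: r => [|l r IH]; first by rewrite big_nil size_poly1.
      rewrite big_cons (leq_trans (size_polyMleq _ _))//.
      have : (size (fac m l) <= 2)%N.
        rewrite (leq_trans (size_scale_leq _ _))// (leq_trans (size_polyD _ _))//.
        by rewrite size_polyN size_polyX geq_max size_polyC; case: (x l != 0).
      by move: IH; set a := size _; set b := size _; rewrite /=; lia.
    rewrite /L -big_filter (leq_trans (szL _))//.
    (* The factor [l = m] is left out, so at most [k - 1] linear factors remain. *)
    rewrite size_filter -[X in (_ < X)%N](@size_iota 1 k).
    rewrite -(count_predC (pred1 m) (iota 1 k)) (_ : index_iota 1 k.+1 = iota 1 k).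
      rewrite -addn1 addnC leq_add//.
      by rewrite -has_count; apply/hasP; exists m; rewrite ?mem_iota ?m0//=.
    by rewrite /index_iota subn1.
have := congr1 (fun q => q.[0]) p0.
rewrite /p !hornerE horner_sum => /eqP; rewrite subr_eq0 => /eqP sumL.
rewrite -[RHS]sumL.
apply: eq_bigr => m _; rewrite horner_prod; apply: eq_bigr => l _.
by rewrite !hornerE subr0 mulrC.
Qed.

Section linear_ode.
Context {R : realType}.

(** The product of [f] with [expR (a * s)] has zero derivative on the open half-line, so the mean
    value theorem makes it constant. At 0 one-sided continuity is enough, which suits functions
    controlled at nonnegative times only. *)
Lemma linear_ode_zero (f : R -> R) (a : R) :
  (forall s : R, 0 < s -> is_derive s (1 : R) f (- a * f s)) ->
  f s @[s --> (0 : R)^'+] --> f 0 -> f 0 = 0 -> forall s, 0 <= s -> f s = 0.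
Proof.
move=> df cf f0 s; rewrite le_eqVlt => /predU1P[<-//|s0].
pose g s := f s * expR (a * s).
have dg (u : R) : 0 < u -> is_derive u (1 : R) g 0.
  move=> u0; have fu := df _ u0.
  have eu : is_derive u (1 : R) (fun u => expR (a * u)) (expR (a * u) * a).
    have -> : (fun u => expR (a * u)) = expR \o (a \*: (@id R)) by [].
    apply: is_derive1_comp.
    by apply: is_derive_eq; rewrite /GRing.scale/= mulr1.
  have dfe := is_deriveM fu eu.
  rewrite (_ : g = f * (fun u => expR (a * u)))//.
  apply: (is_derive_eq dfe).
  rewrite /GRing.scale/=; ring.
have [|||c _ ] := @MVT R g (cst 0) 0 s.
- exact: s0.
- by move=> u; rewrite in_itv/= => /andP[u0 _]; exact: dg.
- apply/continuous_within_itvP => //; split.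
  + move=> u; rewrite in_itv/= => /andP[u0 _].
    apply: differentiable_continuous.
    by apply/derivable1_diffP; have [] := dg _ u0.
  + rewrite /g; apply: cvgM; first exact: cf.
    apply: cvg_at_right_filter; apply: continuous_comp; last exact: continuous_expR.
    exact: mulrl_continuous.
  + apply: cvg_at_left_filter; apply: differentiable_continuous.
    by apply/derivable1_diffP; have [] := dg _ s0.
by rewrite mul0r /g f0 mul0r subr0 => /eqP; rewrite mulf_eq0 (gt_eqF (expR_gt0 _)) orbF => /eqP.
Qed.

End linear_ode.

Lemma cvg_sum_nat (R : realType) {T : Type} (F : set_system T) {FF : Filter F}
    (m n : nat) (f : nat -> T -> R) (l : nat -> R) :
  (forall i, (m <= i)%N -> (i < n)%N -> f i x @[x --> F] --> l i) ->
  \sum_(m <= i < n) f i x @[x --> F] --> \sum_(m <= i < n) l i.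
Proof.
move=> fl.
under eq_cvg do rewrite big_nat.
rewrite [\sum_(m <= i < n) l i]big_nat.
by apply: (@cvg_big R) => //[|i /andP[]]; [exact: add_continuous|exact: fl].
Qed.

(** * Kolmogorov's forward equation from transition rates *)

Section forward_equation.
Context {R : realType}.
Variables (q : nat -> R -> R) (p : R -> nat -> nat -> R) (Q : nat -> nat -> R).
Hypothesis q01 : forall i (s : R), 0 <= s -> 0 <= q i s <= 1.
Hypothesis q_evol : forall j (s h : R), (0 < j)%N -> 0 <= s -> 0 <= h ->
  q j (s + h) = \sum_(1 <= i < j.+1) q i s * p h i j.
Hypothesis p_rates : forall i j, (0 < i)%N -> (0 < j)%N ->
  (p h i j - (i == j)%:R) / h @[h --> (0 : R)^'+] --> Q i j.

Let q_incr j (s h : R) : (0 < j)%N -> 0 <= s -> 0 <= h ->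
  q j (s + h) - q j s = \sum_(1 <= i < j.+1) q i s * (p h i j - (i == j)%:R).
Proof.
move=> j0 s0 h0; rewrite q_evol//.
under [RHS]eq_bigr do rewrite mulrBr.
rewrite sumrB; congr (_ - _).
rewrite (bigD1_seq j) ?mem_index_iota ?iota_uniq ?j0 ?leqnn//= eqxx mulr1.
by rewrite big1 ?addr0// => i /negbTE->; rewrite mulr0.
Qed.

(** A modulus of continuity for [q j] that does not depend on the base point. This uniformity also
    gives left-continuity, where the increment starts at the moving time [s - h]. *)
Let dev j (h : R) : R := \sum_(1 <= i < j.+1) `|p h i j - (i == j)%:R|.

Let p_cvg i j : (0 < i)%N -> (0 < j)%N ->
  p h i j - (i == j)%:R @[h --> (0 : R)^'+] --> (0 : R).
Proof.
move=> i0 j0; rewrite -[X in _ --> X](mulr0 (Q i j)).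
apply: (@cvg_trans _ ((p h i j - (i == j)%:R) / h * h @[h --> (0 : R)^'+])).
  apply: near_eq_cvg; near=> h.
  by rewrite divfK// gt_eqF//; near: h; exact: nbhs_right_gt.
by apply: cvgM; [exact: p_rates|exact: (cvg_at_right_filter (@cvg_id _ _))].
Unshelve. all: by end_near. Qed.

Let dev_cvg j : (0 < j)%N -> dev j h @[h --> (0 : R)^'+] --> (0 : R).
Proof.
move=> j0; rewrite [X in _ --> X](_ : _ = \sum_(1 <= i < j.+1) (0 : R)); last by rewrite big1.
apply: cvg_sum_nat => i i0 _.
have := cvg_norm (p_cvg i0 j0); rewrite normr0; exact.
Qed.

Let q_modulus j (s h : R) : (0 < j)%N -> 0 <= s -> 0 <= h ->
  `|q j (s + h) - q j s| <= dev j h.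
Proof.
move=> j0 s0 h0; rewrite q_incr// (le_trans (ler_norm_sum _ _ _))// ler_sum// => i _.
have /andP[q0 q1] := q01 i s0.
by rewrite normrM ger0_norm// ler_piMl.
Qed.

Lemma forward_cvg_right j (s : R) : (0 < j)%N -> 0 <= s ->
  q j (s + h) @[h --> (0 : R)^'+] --> q j s.
Proof.
move=> j0 s0; apply/cvgrPdist_le => e e0.
have /cvgrPdist_le/(_ e e0) := dev_cvg j0; apply: filter_app; near=> h.
have h0 : 0 <= h by apply: ltW; near: h; exact: nbhs_right_gt.
rewrite sub0r normrN distrC => /(le_trans (ler_norm _)).
by apply: le_trans; exact: q_modulus.
Unshelve. all: by end_near. Qed.

Lemma forward_cvg_left j (s : R) : (0 < j)%N -> 0 < s ->
  q j (s - h) @[h --> (0 : R)^'+] --> q j s.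
Proof.
move=> j0 s0; apply/cvgrPdist_le => e e0.
have /cvgrPdist_le/(_ e e0) := dev_cvg j0; apply: filter_app; near=> h.
have h0 : 0 <= h by apply: ltW; near: h; exact: nbhs_right_gt.
rewrite sub0r normrN => /(le_trans (ler_norm _)); apply: le_trans.
rewrite -{1}(subrK h s); apply: q_modulus => //.
by rewrite subr_ge0; near: h; exact: nbhs_right_le.
Unshelve. all: by end_near. Qed.

(** The two one-sided difference quotients are treated separately. On the right the weights [q i s]
    are fixed; on the left the evolution starts at [s - h], and [forward_cvg_left] handles the
    moving weights [q i (s - h)]. *)
Lemma forward_is_derive j (s : R) : (0 < j)%N -> 0 < s ->
  is_derive s (1 : R) (q j) (\sum_(1 <= i < j.+1) q i s * Q i j).
Proof.
move=> j0 s0.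
suff dq : h^-1 *: ((q j \o shift s) (h *: (1 : R)) - q j s) @[h --> (0 : R)^'] -->
    \sum_(1 <= i < j.+1) q i s * Q i j.
  by apply: DeriveDef; [apply/cvg_ex; eexists; exact: dq|exact/cvg_lim].
apply: (@cvg_at_right_left_dnbhs R R^o).
  apply: (@cvg_trans _ (\sum_(1 <= i < j.+1) q i s * ((p h i j - (i == j)%:R) / h)
      @[h --> (0 : R)^'+])).
    apply: near_eq_cvg; near=> h.
    have h0 : 0 <= h by apply: ltW; near: h; exact: nbhs_right_gt.
    rewrite /= /GRing.scale/= mulr1 [h + s]addrC q_incr ?(ltW s0)// mulrC mulr_suml.
    by under eq_bigr do rewrite mulrA.
  apply: cvg_sum_nat => i i0 _; apply: cvgM; first exact: cvg_cst.
  exact: p_rates.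
apply/(@cvg_at_leftNP _ _ _ 0); rewrite oppr0.
apply: (@cvg_trans _ (\sum_(1 <= i < j.+1) q i (s - h) * ((p h i j - (i == j)%:R) / h)
    @[h --> (0 : R)^'+])).
  apply: near_eq_cvg; near=> h.
  have h0 : 0 <= h by apply: ltW; near: h; exact: nbhs_right_gt.
  have sh0 : 0 <= s - h by rewrite subr_ge0; near: h; exact: nbhs_right_le.
  rewrite /= /GRing.scale/= mulr1 [- h + s]addrC invrN mulNr -mulrN opprB.
  rewrite -{2}(subrK h s) q_incr// mulrC mulr_suml.
  by under eq_bigr do rewrite mulrA.
apply: cvg_sum_nat => i i0 _; apply: cvgM; last exact: p_rates.
exact: forward_cvg_left.
Unshelve. all: by end_near. Qed.

End forward_equation.

(** * The hypoexponential survival function and its differential equation *)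

Section hypoexponential_tail.
Context {R : realType}.
Variable lambda : nat -> R.
Hypothesis lambda_distinct : forall i j : nat, (1 <= i)%N -> (1 <= j)%N ->
  i <> j -> lambda i <> lambda j.

Definition hypoexp_coef (k m : nat) : R :=
  \prod_(1 <= l < k.+1 | l != m) (lambda l / (lambda l - lambda m)).

(** Survival function at [s] of a sum of independent exponential variables with rates [lambda 1],
    ..., [lambda k], that is, of the time at which the birth process leaves state [k]. For [k = 0]
    the empty sum gives 0. *)
Definition hypoexp_tail (k : nat) (s : R) : R :=
  \sum_(1 <= m < k.+1) hypoexp_coef k m * expR (- lambda m * s).

Lemma hypoexp_tail0 k : (0 < k)%N -> hypoexp_tail k 0 = 1.
Proof.
move=> k0; rewrite -[RHS](sum_lagrange_basis_at0 k0 lambda_distinct).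
by apply: eq_bigr => m _; rewrite mulr0 expR0 mulr1.
Qed.

Lemma hypoexp_coefS k m : (1 <= m)%N -> (m <= k)%N ->
  hypoexp_coef k.+1 m = hypoexp_coef k m * (lambda k.+1 / (lambda k.+1 - lambda m)).
Proof.
move=> m0 mk; rewrite /hypoexp_coef big_mkcond big_nat_recr//= -big_mkcond/=.
by rewrite gtn_eqF.
Qed.

(** Holds term by term: for [m <= k], [hypoexp_coefS] relates the coefficients of the two tails
    through [lambda k.+1 - lambda m]; the exponential of rate [lambda k.+1] has no counterpart in
    [hypoexp_tail k]. *)
Lemma hypoexp_tail_is_derive k (s : R) :
  is_derive s (1 : R) (hypoexp_tail k.+1)
    (- lambda k.+1 * (hypoexp_tail k.+1 s - hypoexp_tail k s)).
Proof.
have de (a : R) : is_derive s (1 : R) (fun s => expR (a * s)) (a * expR (a * s)).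
  have -> : (fun u => expR (a * u)) = expR \o (a \*: (@id R)) by [].
  rewrite mulrC; apply: is_derive1_comp.
  by apply: is_derive_eq; rewrite /GRing.scale/= mulr1.
have dS : is_derive s (1 : R) (hypoexp_tail k.+1)
    (\sum_(1 <= m < k.+2) hypoexp_coef k.+1 m * (- lambda m * expR (- lambda m * s))).
  rewrite /hypoexp_tail; elim: (index_iota 1 k.+2) => [|m r IH].
    under eq_fun do rewrite big_nil.
    by rewrite big_nil; exact: is_derive_cst.
  under eq_fun do rewrite big_cons.
  rewrite big_cons; apply: is_deriveD.
apply: (is_derive_eq dS).
rewrite big_nat_recr//= {1}/hypoexp_tail [in RHS]big_nat_recr//= addrAC mulrDr.
rewrite mulrCA; congr (_ + _).
rewrite /hypoexp_tail -sumrB mulr_sumr big_nat [RHS]big_nat.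
apply: eq_bigr => m /andP[m0 mk]; rewrite hypoexp_coefS//.
have : lambda k.+1 - lambda m != 0.
  rewrite subr_eq0; apply/eqP; apply: lambda_distinct => //.
  by apply/eqP; rewrite gtn_eqF.
by move=> lkm; field.
Qed.

End hypoexponential_tail.

(** * Marginals of the pure birth process *)

Section pure_birth.
Context {R : realType} {d : measure_display} {Omega : measurableType d}.
Variable P : probability Omega R.
Variables (lambda : nat -> R) (N : R -> {RV P >-> nat}).
Hypothesis lambda_gt0 : forall i : nat, (1 <= i)%N -> 0 < lambda i.
Hypothesis lambda_distinct : forall i j : nat, (1 <= i)%N -> (1 <= j)%N ->
  i <> j -> lambda i <> lambda j.
Hypothesis N_birth : pure_birth_process lambda N.

Lemma measurable_rv_nat (X : {RV P >-> nat}) (A : set nat) :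
  measurable [set w | A (X w)].
Proof. by rewrite -[X in measurable X]setTI; exact: measurable_funP. Qed.

Lemma birth_ge1 (s : R) w : 0 <= s -> (1 <= N s w)%N.
Proof.
by move=> s0; rewrite -(birth_start N_birth w); exact: (birth_nondecreasing N_birth).
Qed.

Definition state_prob (j : nat) (s : R) : R := fine (P [set w | N s w = j]).

Lemma state_probE j s : (state_prob j s)%:E = P [set w | N s w = j].
Proof. by rewrite fineK// fin_num_measure//; exact: (measurable_rv_nat _ [set j]). Qed.

Lemma state_prob_bounds j (s : R) : 0 <= s -> 0 <= state_prob j s <= 1.
Proof.
by move=> _; rewrite -!lee_fin state_probE measure_ge0/=;
  apply: probability_le1; exact: (measurable_rv_nat _ [set j]).
Qed.

Lemma state_prob_at0 (s : R) : 0 <= s -> state_prob 0 s = 0.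
Proof.
move=> s0; rewrite /state_prob (_ : [set _ | _] = set0) ?measure0//.
by rewrite -subset0 => w /= Nw; have := birth_ge1 w s0; rewrite Nw.
Qed.

Lemma prob_split_nat (X : Omega -> nat) (A : set Omega) (n : nat) :
  (forall i, measurable [set w | X w = i]) ->
  measurable A -> (forall w, A w -> (X w < n)%N) ->
  P A = (\sum_(0 <= i < n) P (A `&` [set w | X w = i]))%E.
Proof.
move=> mX mA AX; rewrite big_mkord -(@measure_bigsetU_ord _ _ _ P _ predT).
- congr (P _); rewrite -(bigcup_mkord n (fun i => A `&` [set w | X w = i])).
  apply/seteqP; split => [w Aw|w [i _ []//]].
  by exists (X w); [exact: AX|].
- by move=> i; exact: measurableI.
- by apply/trivIsetP => i j _ _ ij; rewrite -subset0 => w [[_ /= Xi] [_ /= Xj]];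
    move: ij; rewrite -val_eqE /= -Xi -Xj eqxx.
Qed.

(** Chapman-Kolmogorov: split on the state at time [s] and apply the Markov property with the whole
    space as past event. The sum stops at [j] because paths are nondecreasing. *)
Lemma state_prob_evolution (p : R -> nat -> nat -> R) :
  markov_with_transition N p -> forall j (s h : R), (0 < j)%N -> 0 <= s -> 0 <= h ->
  state_prob j (s + h) = \sum_(1 <= i < j.+1) state_prob i s * p h i j.
Proof.
move=> markovN j s h j0 s0 h0; apply: EFin_inj.
rewrite state_probE (@prob_split_nat (N s) _ j.+1).
(* The state 0 is never occupied and is dropped: the Markov property concerns positive states
   only. *)
- rewrite big_nat_recl//= [X in P X](_ : _ = set0) ?measure0 ?add0e; last first.
    by rewrite -subset0 => w [_ /= Nw]; have := birth_ge1 w s0; rewrite Nw.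
  rewrite -sumEFin big_add1/=; apply: eq_bigr => i _.
  have := markovN s h i.+1 j setT s0 h0 isT j0.
  rewrite setTI setIC => -> //; first by rewrite -state_probE -EFinM mulrC.
  move=> C [[C0 CD CU] _]; rewrite -(setCK setT).
  by rewrite -setTD; apply: (CD); rewrite setCT.
- by move=> i; exact: (measurable_rv_nat _ [set i]).
- exact: (measurable_rv_nat _ [set j]).
- move=> w /= <-; rewrite ltnS; apply: (birth_nondecreasing N_birth) => //.
  by rewrite lerDl.
Qed.

(** Only the diagonal rate and the rate from the previous state survive in the forward equation. The
    formula covers state 1 too: for [j = 0] the inflow term vanishes because state 0 is never
    occupied. *)
Lemma state_prob_forward :
  (forall j (s : R), 0 < s -> is_derive s (1 : R) (state_prob j.+1)
     (lambda j * state_prob j s - lambda j.+1 * state_prob j.+1 s)) /\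
  (forall j, state_prob j.+1 s @[s --> (0 : R)^'+] --> state_prob j.+1 0).
Proof.
have [p [markovN rates]] := birth_markov N_birth.
have evol := state_prob_evolution markovN.
split => [j s s0|j].
  have := forward_is_derive state_prob_bounds evol rates (ltn0Sn j) s0.
  move/is_derive_eq; apply.
  rewrite big_nat_recr//= /birth_rates ltn_eqF// eqxx mulrN mulrC; congr (_ - _).
  case: j => [|j]; first by rewrite big_geq// state_prob_at0 ?mulr0// ltW.
  rewrite big_nat_recr//= eqxx mulrC big_nat big1 ?add0r// => i /andP[_ ij].
  by rewrite !eqSS !gtn_eqF ?mulr0// (leq_trans ij).
have := forward_cvg_right state_prob_bounds evol rates (ltn0Sn j) (lexx 0).
by under eq_cvg do rewrite add0r.
Qed.

Definition birth_cdf (k : nat) (s : R) : R := \sum_(1 <= j < k.+1) state_prob j s.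

Lemma birth_cdfE k (s : R) : 0 <= s -> P [set w | (N s w <= k)%N] = (birth_cdf k s)%:E.
Proof.
move=> s0; rewrite (@prob_split_nat (N s) _ k.+1).
- rewrite big_nat_recl//= [X in P X](_ : _ = set0) ?measure0 ?add0e; last first.
    by rewrite -subset0 => w [_ /= Nw]; have := birth_ge1 w s0; rewrite Nw.
  rewrite /birth_cdf -sumEFin big_add1/= big_nat [RHS]big_nat.
  apply: eq_bigr => i ik; rewrite state_probE; congr (P _).
  by apply/seteqP; split => [w []//|w /= Nw]; split => //=; rewrite Nw.
- by move=> i; exact: (measurable_rv_nat _ [set i]).
- exact: (measurable_rv_nat _ [set i | (i <= k)%N]).
- by [].
Qed.

Lemma birth_cdf_start k : (0 < k)%N -> birth_cdf k 0 = 1.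
Proof.
move=> k0; apply: EFin_inj; rewrite -birth_cdfE//.
rewrite -(probability_setT P); congr (P _); apply/seteqP; split => // w _ /=.
by rewrite (birth_start N_birth).
Qed.

Lemma birth_cdf_bounds k (s : R) : 0 <= s -> 0 <= birth_cdf k s <= 1.
Proof.
move=> s0; rewrite -!lee_fin -birth_cdfE// measure_ge0/=.
apply: probability_le1; exact: (measurable_rv_nat _ [set i | (i <= k)%N]).
Qed.

Lemma birth_cdf_nonincreasing k (s u : R) : 0 <= s -> s <= u ->
  birth_cdf k u <= birth_cdf k s.
Proof.
move=> s0 su; rewrite -lee_fin -!birth_cdfE//; last exact: le_trans su.
apply: le_measure; rewrite ?inE; [exact: (measurable_rv_nat _ [set i | (i <= k)%N])..|].
by move=> w /=; apply: leq_trans; exact: (birth_nondecreasing N_birth).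
Qed.

(** The forward equations telescope: the inflow into each state cancels the outflow from the
    previous one, leaving the outflow from [k]. *)
Lemma birth_cdf_is_derive k (s : R) : 0 < s ->
  is_derive s (1 : R) (birth_cdf k) (- lambda k * state_prob k s).
Proof.
move=> s0; elim: k => [|k IH].
  rewrite state_prob_at0 ?(ltW s0)// mulr0 /birth_cdf.
  under eq_fun do rewrite big_geq//.
  exact: is_derive_cst.
have -> : birth_cdf k.+1 = birth_cdf k + state_prob k.+1.
  by apply/funext => u; rewrite /birth_cdf big_nat_recr.
have dq := state_prob_forward.1 k s s0.
apply: (is_derive_eq (is_deriveD IH dq)); ring.
Qed.

Lemma birth_cdf_cvg0 k : birth_cdf k s @[s --> (0 : R)^'+] --> birth_cdf k 0.
Proof.
apply: cvg_sum_nat => -[//|j] _ _; exact: state_prob_forward.2.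
Qed.

(** Induction on [k]: once the two functions agree at [k], their difference at [k.+1] solves a
    homogeneous linear equation and starts from 0. *)
Lemma birth_cdf_closed_form k (s : R) : 0 <= s -> birth_cdf k s = hypoexp_tail lambda k s.
Proof.
elim: k s => [|k IH] s s0; first by rewrite /birth_cdf /hypoexp_tail !big_geq.
apply/eqP; rewrite -subr_eq0; apply/eqP.
apply: (@linear_ode_zero _ (birth_cdf k.+1 - hypoexp_tail lambda k.+1) (lambda k.+1)) => //.
- move=> u u0; have dF := birth_cdf_is_derive k.+1 u0.
  have dS := hypoexp_tail_is_derive lambda_distinct k u.
  apply: (is_derive_eq (is_deriveB dF dS)).
  rewrite -IH ?(ltW u0)// !fctE.
  rewrite (_ : state_prob k.+1 u = birth_cdf k.+1 u - birth_cdf k u); first by ring.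
  by rewrite /birth_cdf big_nat_recr//= addrAC subrr add0r.
- apply: cvgB; first exact: birth_cdf_cvg0.
  apply: cvg_at_right_filter; apply: differentiable_continuous.
  apply/derivable1_diffP.
  by have [] := hypoexp_tail_is_derive lambda_distinct k 0.
- by rewrite !fctE birth_cdf_start// hypoexp_tail0// subrr.
Qed.

Definition birth_cdf_primitive (k : nat) (s : R) : R :=
  - \sum_(1 <= j < k.+1) birth_cdf j s / lambda j.

(** For each [j >= 1], [- birth_cdf j / lambda j] is a primitive of [state_prob j], and these
    probabilities add up to [birth_cdf k]. *)
Lemma birth_cdf_primitive_is_derive k (s : R) : 0 < s ->
  is_derive s (1 : R) (birth_cdf_primitive k) (birth_cdf k s).
Proof.
move=> s0; elim: k => [|k IH].
  rewrite /birth_cdf_primitive /birth_cdf big_geq//.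
  under eq_fun do rewrite big_geq//.
  by rewrite oppr0; exact: is_derive_cst.
have -> : birth_cdf_primitive k.+1 =
    birth_cdf_primitive k + (- (lambda k.+1)^-1) \*: birth_cdf k.+1.
  apply/funext => u; rewrite /birth_cdf_primitive big_nat_recr//= opprD mulrC.
  by rewrite -mulNr.
have dF := is_deriveZ (- (lambda k.+1)^-1) (birth_cdf_is_derive k.+1 s0).
apply: (is_derive_eq (is_deriveD IH dF)).
rewrite /GRing.scale/= mulNr mulNr mulrN opprK mulKf ?gt_eqF ?lambda_gt0//.
by rewrite /birth_cdf [RHS]big_nat_recr.
Qed.

Lemma birth_cdf_primitive_cvg0 k :
  birth_cdf_primitive k s @[s --> (0 : R)^'+] --> birth_cdf_primitive k 0.
Proof.
apply: cvgN; apply: cvg_sum_nat => j _ _; apply: cvgM; last exact: cvg_cst.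
exact: birth_cdf_cvg0.
Qed.

(** Passing from [k] to [k.+1] adds one term to the primitive, and [birth_cdf k.+1] equals 1 at time
    0. *)
Lemma birth_cdf_primitive_increment k (t : R) : 0 < t ->
  (birth_cdf_primitive k.+1 t - birth_cdf_primitive k.+1 0) / t -
    (birth_cdf_primitive k t - birth_cdf_primitive k 0) / t =
  (lambda k.+1 * t)^-1 * (1 - birth_cdf k.+1 t).
Proof.
move=> t0; have l0 := lambda_gt0 (ltn0Sn k).
have primS u : birth_cdf_primitive k.+1 u =
    birth_cdf_primitive k u - birth_cdf k.+1 u / lambda k.+1.
  by rewrite /birth_cdf_primitive big_nat_recr//= opprD.
rewrite -(@birth_cdf_start k.+1)// !primS.
by field; rewrite !gt_eqF.
Qed.

End pure_birth.

(** * Riemann sums of a nonincreasing function *)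

Section riemann_sum_monotone.
Context {R : realType}.
Variables (F A : R -> R).
Hypothesis dA : forall s : R, 0 < s -> is_derive s (1 : R) A (F s).
Hypothesis cA : A s @[s --> (0 : R)^'+] --> A 0.
Hypothesis F_noninc : forall s u : R, 0 <= s -> s <= u -> F u <= F s.
Hypothesis F01 : forall s : R, 0 <= s -> 0 <= F s <= 1.

Let increment_bounds (a b : R) : 0 <= a -> a < b ->
  F b * (b - a) <= A b - A a <= F a * (b - a).
Proof.
move=> a0 ab.
have [||c] := @MVT R A F a b ab.
- by move=> x; rewrite in_itv/= => /andP[ax _]; apply: dA; exact: le_lt_trans ax.
- have cont (x : R) : 0 < x -> {for x, continuous A}.
    by move=> x0; apply: differentiable_continuous; apply/derivable1_diffP; have [] := dA x0.
  apply/continuous_within_itvP => //; split.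
  + by move=> x; rewrite in_itv/= => /andP[ax _]; apply: cont; exact: le_lt_trans ax.
  + move: a0; rewrite le_eqVlt => /predU1P[<-//|a0].
    by apply: cvg_at_right_filter; exact: cont.
  + by apply: cvg_at_left_filter; apply: cont; exact: le_lt_trans ab.
rewrite in_itv/= => /andP[/ltW ac /ltW cb] ->.
by rewrite !ler_pM2r ?subr_gt0// !F_noninc// (le_trans a0).
Qed.

(** The left Riemann sum overestimates the increment of [A] and the right one underestimates it;
    they differ by [(F 0 - F t) * t / n], which is at most [t / n]. *)
Lemma riemann_sum_monotone (t : R) (n : nat) : 0 < t -> (0 < n)%N ->
  `|(\sum_(0 <= c < n) F (c%:R * t / n%:R)) / n%:R - (A t - A 0) / t| <= n%:R^-1.
Proof.
move=> t0 n0; pose x c : R := c%:R * t / n%:R.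
have n0R : 0 < n%:R :> R by rewrite ltr0n.
have tn0 : 0 < t / n%:R by rewrite divr_gt0.
have x0 c : 0 <= x c by rewrite divr_ge0// mulr_ge0// ltW.
have dx c : x c.+1 - x c = t / n%:R by rewrite /x -natr1; field; rewrite gt_eqF.
have xS c : x c < x c.+1 by rewrite -subr_gt0 dx.
have xn : x n = t by rewrite /x; field; rewrite gt_eqF.
have xz : x 0%N = 0 by rewrite /x !mul0r.
have telA : \sum_(0 <= c < n) (A (x c.+1) - A (x c)) = A t - A 0.
  by rewrite telescope_sumr// xn xz.
have telF : \sum_(0 <= c < n) (F (x c.+1) - F (x c)) = F t - F 0.
  by rewrite (telescope_sumr (fun c => F (x c)))// xn xz.
have ub : A t - A 0 <= (\sum_(0 <= c < n) F (x c)) * (t / n%:R).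
  rewrite -telA mulr_suml; apply: ler_sum => c _.
  by have /andP[_] := increment_bounds (x0 c) (xS c); rewrite dx.
have lb : (\sum_(0 <= c < n) F (x c.+1)) * (t / n%:R) <= A t - A 0.
  rewrite -telA mulr_suml; apply: ler_sum => c _.
  by have /andP[+ _] := increment_bounds (x0 c) (xS c); rewrite dx.
move: telF; rewrite sumrB => /eqP; rewrite subr_eq => /eqP telF.
have /andP[Ft0 _] := F01 (ltW t0); have /andP[_ F0] := F01 (lexx 0).
move: ub lb; rewrite telF -/x; set S := \sum_(0 <= c < n) F (x c) => ub lb.
have -> : S / n%:R - (A t - A 0) / t = (S * (t / n%:R) - (A t - A 0)) / t.
  by field; rewrite !gt_eqF.
rewrite normrM [`|t^-1|]gtr0_norm ?invr_gt0// ler_pdivrMr// [n%:R^-1 * t]mulrC.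
rewrite ger0_norm ?subr_ge0// lerBlDl -lerBlDr (le_trans _ lb)//.
rewrite -{2}[t / n%:R]mul1r -mulrBl ler_pM2r//; lra.
Qed.

End riemann_sum_monotone.

(** * Laws determined by linear forms *)

Section bounded_random_variables.
Context {R : realType} {d : measure_display} {Omega : measurableType d}.
Variable P : probability Omega R.

Lemma bounded_integrable (f : Omega -> R) (C : R) :
  measurable_fun setT f -> (forall w, `|f w| <= C) -> P.-integrable setT (EFin \o f).
Proof.
move=> mf fC; apply: (@le_integrable _ _ _ _ _ _ _ (EFin \o cst C)) => //.
- exact/measurable_EFinP.
- by move=> w _ /=; rewrite lee_fin (le_trans (fC w))// ler_norm.
- exact: finite_measure_integrable_cst.
Qed.

Lemma bounded_cvg_integral (f_ : nat -> Omega -> R) (f : Omega -> R) (C : R) :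
  (forall m, measurable_fun setT (f_ m)) -> measurable_fun setT f ->
  (forall m w, `|f_ m w| <= C) ->
  (\forall w \ae P, f_ m w @[m --> \oo] --> f w) ->
  (\int[P]_w (f_ m w)%:E @[m --> \oo] --> \int[P]_w (f w)%:E)%E.
Proof.
move=> mf_ mf f_C f_f.
have [] := @dominated_convergence _ _ _ P setT measurableT
  (fun m => EFin \o f_ m) (EFin \o f) (EFin \o cst C) _ _ _ _ _.
- by move=> m; exact/measurable_EFinP.
- exact/measurable_EFinP.
- by apply: filterS f_f => w f_f _; apply: cvg_EFin => //; near=> m.
- exact: finite_measure_integrable_cst.
- by apply: aeW => w m _ /=; rewrite lee_fin.
- by move=> _ _.
Unshelve. all: by end_near. Qed.

End bounded_random_variables.

(** * Polynomial iteration towards the sign function *)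

Section sign_approximation.
Context {R : realType}.

(* Fixes -1, 0 and 1; on [-1, 1] its iterates converge to the sign, so that the
   indicator of a half-space is a bounded limit of trigonometric polynomials. *)
Definition sharpen (r : R) : R := (3 * r - r ^+ 3) / 2.

Lemma sharpen_bound (r : R) : `|r| <= 1 -> `|sharpen r| <= 1.
Proof.
rewrite /sharpen !ler_norml => /andP[r1 r2].
have h1 : 0 <= (1 - r) ^+ 2 * (2 + r) by rewrite mulr_ge0 ?sqr_ge0//; lra.
have h2 : 0 <= (1 + r) ^+ 2 * (2 - r) by rewrite mulr_ge0 ?sqr_ge0//; lra.
by apply/andP; split; nra.
Qed.

Lemma iter_sharpen_bound k (y : R) : `|y| <= 1 -> `|iter k sharpen y| <= 1.
Proof. by move=> y1; elim: k => //= k; exact: sharpen_bound. Qed.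

Lemma iter_sharpenN k (y : R) : iter k sharpen (- y) = - iter k sharpen y.
Proof. by elim: k => //= k ->; rewrite /sharpen; field. Qed.

(** The distance to 1 obeys [1 - sharpen r = (1 - r)^2 * (2 + r) / 2]. Iterates never fall below
    [y], and for [r >= y] one iteration multiplies this distance by at most [1 - y / 2]. *)
Lemma iter_sharpen_pos k (y : R) : 0 < y <= 1 ->
  y <= iter k sharpen y <= 1 /\ 1 - iter k sharpen y <= (1 - y / 2) ^+ k.
Proof.
move=> /andP[y0 y1]; elim: k => [|k]; first by rewrite expr0 /=; split; [apply/andP; split|]; lra.
rewrite [iter k.+1 _ _]/= exprS; set r := iter k sharpen y => -[/andP[yr r1] re].
have r0 : 0 <= r by lra.
have h0 : 0 <= r * ((1 - r) * (1 + r)) by rewrite !mulr_ge0//; lra.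
have h1 : 0 <= (1 - r) ^+ 2 * (2 + r) by rewrite mulr_ge0 ?sqr_ge0//; lra.
have rr : r <= sharpen r by rewrite /sharpen; nra.
have r1' : sharpen r <= 1 by rewrite /sharpen; nra.
split; first by rewrite r1' (le_trans yr).
apply: (@le_trans _ _ ((1 - y / 2) * (1 - r))); last by rewrite ler_wpM2l//; lra.
have -> : 1 - sharpen r = (1 - r) * ((1 - r) * (2 + r) / 2) by rewrite /sharpen; field.
rewrite mulrC ler_wpM2r//; nra.
Qed.

Lemma iter_sharpen_cvg (y : R) : `|y| <= 1 ->
  iter k sharpen y @[k --> \oo] --> Num.sg y.
Proof.
have pos (z : R) : 0 < z <= 1 -> iter k sharpen z @[k --> \oo] --> (1 : R).
  move=> z01; have [z0 z1] := andP z01.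
  apply: (@squeeze_cvgr _ _ _ _ (fun k => 1 - (1 - z / 2) ^+ k) (cst 1)); last 2 first.
  - rewrite -[X in _ --> X]subr0; apply: cvgB; first exact: cvg_cst.
    by apply: cvg_expr; rewrite ger0_norm; lra.
  - exact: cvg_cst.
  - near=> k; have [/andP[_ ->] ] := iter_sharpen_pos k z01.
    by rewrite andbT lerBlDr -lerBlDl.
rewrite ler_norml => /andP[yN1 y1]; case: (ltgtP y 0) => [y0|y0|->].
- rewrite ltr0_sg// -[y]opprK; under eq_cvg do rewrite iter_sharpenN.
  by apply: cvgN; apply: pos; lra.
- by rewrite gtr0_sg//; apply: pos; rewrite y0.
- have iter0 k : iter k sharpen 0 = 0 :> R.
    by elim: k => //= k ->; rewrite /sharpen mulr0 expr0n subrr mul0r.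
  by rewrite sgr0; under eq_cvg do rewrite iter0; exact: cvg_cst.
Unshelve. all: by end_near. Qed.

(** The map [(s + s^2) / 2] sends -1, 0, 1 to 0, 0, 1, so the limit is the indicator of the open
    half-line. *)
Definition step_approx (k : nat) (y : R) : R :=
  (iter k sharpen y + iter k sharpen y ^+ 2) / 2.

Lemma step_approx_bound k (y : R) : `|y| <= 1 -> `|step_approx k y| <= 1.
Proof.
move=> /(iter_sharpen_bound k); rewrite /step_approx !ler_norml => /andP[? ?].
by apply/andP; split; nra.
Qed.

Lemma step_approx_cvg (y : R) : `|y| <= 1 ->
  step_approx k y @[k --> \oo] --> ((0 < y)%R%:R : R).
Proof.
move=> /iter_sharpen_cvg cy; have -> : (0 < y)%R%:R = (Num.sg y + Num.sg y ^+ 2) / 2 :> R.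
  by case: sgrP => //= _; field.
apply: cvgM; last exact: cvg_cst.
by apply: cvgD => //; rewrite !expr2; exact: cvgM.
Qed.

End sign_approximation.


(** * Joint law of signs from the laws of linear forms *)

Section linear_forms_law.
Context {R : realType} {d : measure_display} {Omega : measurableType d}.
Variables (P : probability Omega R) (n : nat).

Definition dot (a x : 'I_n -> R) : R := \sum_(i < n) a i * x i.

Lemma dotD a b x : dot (fun i => a i + b i) x = dot a x + dot b x.
Proof. by rewrite /dot -big_split/=; apply: eq_bigr => i _; rewrite mulrDl. Qed.

Lemma dotZ (c : R) a x : dot (fun i => c * a i) x = c * dot a x.
Proof. by rewrite /dot mulr_sumr; apply: eq_bigr => i _; rewrite mulrA. Qed.

(** Real trigonometric polynomials: the free phase [th] accounts for sines, and [a = 0] for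
    constants. *)
Inductive trig_poly : (('I_n -> R) -> R) -> Prop :=
| trig_cos a th : trig_poly (fun x => cos (dot a x + th))
| trig_add f g : trig_poly f -> trig_poly g -> trig_poly (fun x => f x + g x)
| trig_scale c f : trig_poly f -> trig_poly (fun x => c * f x).

(** Bilinearity reduces to two cosines, where the product-to-sum formula applies. *)
Lemma trig_poly_mul f g : trig_poly f -> trig_poly g -> trig_poly (fun x => f x * g x).
Proof.
move=> + tg; elim=> [a th|f1 f2 _ t1 _ t2|c f1 _ t1]; last 2 first.
- by under eq_fun do rewrite mulrDl; exact: trig_add.
- by under eq_fun do rewrite -mulrA; exact: trig_scale.
elim: tg => [b ph|g1 g2 _ t1 _ t2|c g1 _ t1]; last 2 first.
- by under eq_fun do rewrite mulrDr; exact: trig_add.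
- by under eq_fun do rewrite mulrCA; exact: trig_scale.
have -> : (fun x => cos (dot a x + th) * cos (dot b x + ph)) =
    (fun x => 2^-1 * (cos (dot (fun i => a i + b i) x + (th + ph)) +
                      cos (dot (fun i => a i + (-1) * b i) x + (th - ph)))).
  apply/funext => x; rewrite !dotD dotZ.
  rewrite (_ : _ + _ + (th + ph) = (dot a x + th) + (dot b x + ph)); last by ring.
  rewrite (_ : _ + _ + (th - ph) = (dot a x + th) - (dot b x + ph)); last by ring.
  move: (dot a x + th) (dot b x + ph) => u v.
  by rewrite cosD cosB; field.
by apply: trig_scale; apply: trig_add; exact: trig_cos.
Qed.

Lemma trig_poly_cst (c : R) : trig_poly (fun=> c).
Proof.
have -> : (fun=> c) = (fun x => c * cos (dot (fun=> 0) x + 0)).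
  apply/funext => x; rewrite /dot big1 ?addr0 ?cos0 ?mulr1// => i _.
  by rewrite mul0r.
by apply: trig_scale; exact: trig_cos.
Qed.

Lemma trig_poly_step_approx k a (c : R) :
  trig_poly (fun x => step_approx k (sin (c * dot a x))).
Proof.
have t0 : trig_poly (fun x => sin (c * dot a x)).
  under eq_fun do rewrite -cosBpihalf -dotZ.
  exact: trig_cos.
have tk : trig_poly (fun x => iter k sharpen (sin (c * dot a x))).
  elim: k => //= k tk; rewrite /sharpen.
  have -> : (fun x => (3 * iter k sharpen (sin (c * dot a x)) -
      iter k sharpen (sin (c * dot a x)) ^+ 3) / 2) =
    (fun x => 2^-1 * (3 * iter k sharpen (sin (c * dot a x)) + (- 1) *
      (iter k sharpen (sin (c * dot a x)) * (iter k sharpen (sin (c * dot a x)) *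
        iter k sharpen (sin (c * dot a x)))))).
    by apply/funext => x; field.
  apply: trig_scale; apply: trig_add; first exact: trig_scale.
  by apply: trig_scale; do 2 apply: trig_poly_mul => //.
rewrite /step_approx.
under eq_fun do rewrite mulrC expr2.
by apply: trig_scale; apply: trig_add => //; exact: trig_poly_mul.
Qed.

Lemma trig_poly_bounded f : trig_poly f -> exists C, forall x, `|f x| <= C.
Proof.
elim=> [a th|f1 f2 _ [C1 h1] _ [C2 h2]|c f1 _ [C h]].
- by exists 1 => x; exact: cos_max.
- by exists (C1 + C2) => x; rewrite (le_trans (ler_normD _ _))// lerD.
- by exists (`|c| * C) => x; rewrite normrM ler_wpM2l.
Qed.

Variables U V : Omega -> 'I_n -> R.
Hypothesis mU : forall i, measurable_fun setT (U ^~ i).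
Hypothesis mV : forall i, measurable_fun setT (V ^~ i).
Hypothesis UV_law : forall a (A : set R), measurable A ->
  P [set w | A (dot a (U w))] = P [set w | A (dot a (V w))].

Let measurable_dot a (W : Omega -> 'I_n -> R) : (forall i, measurable_fun setT (W ^~ i)) ->
  measurable_fun setT (fun w => dot a (W w)).
Proof.
by move=> mW; apply: measurable_sum => i; apply: measurable_funM.
Qed.

Definition same_expectation (f : ('I_n -> R) -> R) : Prop :=
  [/\ measurable_fun setT (f \o U), measurable_fun setT (f \o V) &
      (\int[P]_w (f (U w))%:E = \int[P]_w (f (V w))%:E)%E].

(** The integrand depends on a single linear form, whose law is the same under [U] and [V]; both
    expectations become integrals over the image measure. *)
Lemma same_expectation_cos a th : same_expectation (fun x => cos (dot a x + th)).
Proof.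
have mc : measurable_fun setT (fun y : R => cos (y + th)).
  apply: continuous_measurable_fun => y.
  apply: continuous_comp; last exact: continuous_cos.
  by apply: cvgD; [exact: cvg_id|exact: cvg_cst].
have mdU := measurable_dot a mU; have mdV := measurable_dot a mV.
split; [exact: measurableT_comp mc mdU|exact: measurableT_comp mc mdV|].
have push (W : Omega -> 'I_n -> R) (mW : measurable_fun setT (fun w => dot a (W w))) :
    (\int[P]_w (cos (dot a (W w) + th))%:E =
     \int[pushforward P (fun w => dot a (W w))]_y (cos (y + th))%:E)%E.
  rewrite integral_pushforward//.
  - exact/measurable_EFinP.
  - apply: (@bounded_integrable _ _ _ _ _ 1).
      exact: measurableT_comp mc mW.
    by move=> w; exact: cos_max.
rewrite (push U mdU) (push V mdV).
by apply: eq_measure_integral => A mA _; exact: UV_law.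
Qed.

Lemma same_expectationD f g (C D : R) : (forall x, `|f x| <= C) -> (forall x, `|g x| <= D) ->
  same_expectation f -> same_expectation g -> same_expectation (fun x => f x + g x).
Proof.
move=> fC gD [fU fV fUV] [gU gV gUV]; split.
- exact: (measurable_funD fU gU).
- exact: (measurable_funD fV gV).
under eq_integral do rewrite EFinD.
under [RHS]eq_integral do rewrite EFinD.
rewrite !integralD//; first by rewrite fUV gUV.
- exact: (bounded_integrable P fV (fun w => fC _)).
- exact: (bounded_integrable P gV (fun w => gD _)).
- exact: (bounded_integrable P fU (fun w => fC _)).
- exact: (bounded_integrable P gU (fun w => gD _)).
Qed.

Lemma same_expectationZ c f (C : R) : (forall x, `|f x| <= C) ->
  same_expectation f -> same_expectation (fun x => c * f x).
Proof.
move=> fC [fU fV fUV]; split.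
- by apply: measurable_funM.
- by apply: measurable_funM.
under eq_integral do rewrite EFinM.
under [RHS]eq_integral do rewrite EFinM.
rewrite !integralZl//; first by rewrite fUV.
- exact: (bounded_integrable P fV (fun w => fC _)).
- exact: (bounded_integrable P fU (fun w => fC _)).
Qed.

Lemma same_expectation_lim (f_ : nat -> ('I_n -> R) -> R)
    (f : ('I_n -> R) -> R) (C : R) :
  (forall m x, `|f_ m x| <= C) -> (forall x, f_ m x @[m --> \oo] --> f x) ->
  (forall m, same_expectation (f_ m)) -> same_expectation f.
Proof.
move=> f_C f_f sf_.
have mfU : measurable_fun setT (f \o U).
  apply: (measurable_fun_cvg (h := fun m => f_ m \o U)) => [m|w _]; last exact: f_f.
  by have [] := sf_ m.
have mfV : measurable_fun setT (f \o V).
  apply: (measurable_fun_cvg (h := fun m => f_ m \o V)) => [m|w _]; last exact: f_f.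
  by have [] := sf_ m.
split => //.
have cU : (\int[P]_w (f_ m (U w))%:E @[m --> \oo] --> \int[P]_w (f (U w))%:E)%E.
  apply: (@bounded_cvg_integral _ _ _ P (fun m => f_ m \o U) (f \o U) C) => //.
  - by move=> m; have [] := sf_ m.
  - by move=> m w; exact: f_C.
  - by apply: filterE => w; exact: f_f.
have cV : (\int[P]_w (f_ m (V w))%:E @[m --> \oo] --> \int[P]_w (f (V w))%:E)%E.
  apply: (@bounded_cvg_integral _ _ _ P (fun m => f_ m \o V) (f \o V) C) => //.
  - by move=> m; have [] := sf_ m.
  - by move=> m w; exact: f_C.
  - by apply: filterE => w; exact: f_f.
rewrite -(cvg_lim _ cU)// -(cvg_lim _ cV)//.
by congr (limn _); apply/funext => m; have [] := sf_ m.
Qed.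

Lemma same_expectation_trig f : trig_poly f -> same_expectation f.
Proof.
elim=> [a th|f1 f2 t1 s1 t2 s2|c f1 t1 s1].
- exact: same_expectation_cos.
- have [C1 h1] := trig_poly_bounded t1; have [C2 h2] := trig_poly_bounded t2.
  exact: same_expectationD h1 h2 s1 s2.
- have [C1 h1] := trig_poly_bounded t1.
  exact: same_expectationZ h1 s1.
Qed.

(* Unlike [same_expectation], this is stable under products with indicators of
   half-spaces (lemma trig_sameM_pos). *)
Definition trig_same f := (exists C : R, forall x, `|f x| <= C) /\
  forall g, trig_poly g -> same_expectation (fun x => f x * g x).

Lemma trig_sameD f1 f2 : trig_same f1 -> trig_same f2 -> trig_same (fun x => f1 x + f2 x).
Proof.
move=> [[C1 h1] s1] [[C2 h2] s2]; split.
  by exists (C1 + C2) => x; rewrite (le_trans (ler_normD _ _))// lerD.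
move=> g tg; have [D hD] := trig_poly_bounded tg.
under eq_fun do rewrite mulrDl.
apply: (@same_expectationD _ _ (C1 * D) (C2 * D)); [| |exact: s1|exact: s2].
- by move=> x; rewrite normrM ler_pM.
- by move=> x; rewrite normrM ler_pM.
Qed.

Lemma trig_sameM_trig f h : trig_same f -> trig_poly h -> trig_same (fun x => h x * f x).
Proof.
move=> [[C hC] s] th; have [D hD] := trig_poly_bounded th; split.
  by exists (D * C) => x; rewrite normrM ler_pM.
move=> g tg; under eq_fun do rewrite mulrAC mulrC.
by apply: s; exact: trig_poly_mul.
Qed.

Lemma trig_same_lim (f_ : nat -> ('I_n -> R) -> R)
    (f : ('I_n -> R) -> R) (C : R) :
  (forall m x, `|f_ m x| <= C) -> (forall x, f_ m x @[m --> \oo] --> f x) ->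
  (forall m, trig_same (f_ m)) -> trig_same f.
Proof.
move=> f_C f_f sf_; split.
  exists C => x; apply: (cvgr_to_le (cvg_norm (f_f x))).
  by apply: nearW => m; exact: f_C.
move=> g tg; have [D hD] := trig_poly_bounded tg.
apply: (@same_expectation_lim (fun m x => f_ m x * g x) _ (C * D)).
- by move=> m x; rewrite normrM ler_pM.
- by move=> x; apply: cvgM; [exact: f_f|exact: cvg_cst].
- by move=> m; apply: (sf_ m).2.
Qed.

(** Two nested bounded limits. Once [dot a x / (m + 1)] lies in (-pi, pi), its sine has the sign of
    [dot a x]; the indicator that this sine is positive is in turn the limit of [step_approx], which
    gives trigonometric polynomials. *)
Lemma trig_sameM_pos f a : trig_same f -> trig_same (fun x => (0 < dot a x)%R%:R * f x).
Proof.
move=> sf; have [[C hC] _] := sf.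
have sin1 (y : R) : `|sin y| <= 1 by exact: sin_max.
apply: (@trig_same_lim (fun m x => (0 < sin (m.+1%:R^-1 * dot a x))%R%:R * f x) _ C).
- move=> m x; case: (0 < _); rewrite ?mul1r// mul0r normr0.
  exact: le_trans (normr_ge0 _) (hC x).
- move=> x; apply: cvgM; last exact: cvg_cst.
  apply: (@cvg_trans _ (cst ((0 < dot a x)%R%:R : R) @ \oo)); last exact: cvg_cst.
  apply: near_eq_cvg; near=> m.
  set y := dot a x; have m0 : 0 < m.+1%:R^-1 :> R by rewrite invr_gt0.
  have ym : `|y| < m.+1%:R.
    near: m; exists (Num.truncn `|y|).+1 => // m /= ym.
    rewrite (lt_le_trans (truncnS_gt _))// ler_nat; exact: leqW.
  have ypi : `|m.+1%:R^-1 * y| < pi.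
    rewrite normrM gtr0_norm// mulrC ltr_pdivrMr//.
    rewrite (lt_trans ym)// ltr_pMl//.
    by have := @pihalf_ge1 R; lra.
  suff <- : (0 < sin (m.+1%:R^-1 * y)) = (0 < y) by [].
  move: ypi; rewrite ltr_norml => /andP[ypi1 ypi2].
  have [y0|y0|->] := ltgtP y 0.
  - rewrite lt_gtF// -oppr_gt0 -sinN sin_gt0_pi// -mulrN.
    by rewrite mulr_gt0 ?oppr_gt0//= mulrN ltrNl.
  - by rewrite sin_gt0_pi// mulr_gt0.
  - by rewrite mulr0 sin0 ltxx.
- move=> m.
  apply: (@trig_same_lim (fun k x => step_approx k (sin (m.+1%:R^-1 * dot a x)) * f x) _ C).
  + move=> k x; rewrite normrM -[C]mul1r ler_pM//.
    exact: step_approx_bound.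
  + by move=> x; apply: cvgM; [exact: step_approx_cvg|exact: cvg_cst].
  + by move=> k; apply: trig_sameM_trig => //; exact: trig_poly_step_approx.
Unshelve. all: by end_near. Qed.

(** Induction on the forms, through [F (b :: s) = F (false :: s) + b * (F (true :: s) - F (false ::
    s))] with [b] read as 0 or 1. *)
Lemma trig_same_bits (ls : seq ('I_n -> R)) (F : seq bool -> R) :
  trig_same (fun x => F (map (fun a => (0 < dot a x)%R) ls)).
Proof.
elim: ls F => [|a ls IH] F /=.
  split; first by exists `|F [::]|.
  move=> g tg; apply: same_expectation_trig; exact: trig_scale.
have -> : (fun x => F ((0 < dot a x)%R :: [seq (0 < dot b x)%R | b <- ls])) =
    (fun x => F (false :: [seq (0 < dot b x)%R | b <- ls]) +
      (0 < dot a x)%R%:R * (F (true :: [seq (0 < dot b x)%R | b <- ls]) +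
       (-1) * F (false :: [seq (0 < dot b x)%R | b <- ls]))).
  by apply/funext => x; case: (0 < dot a x) => /=; ring.
apply: trig_sameD; first exact: (IH (fun s => F (false :: s))).
apply: trig_sameM_pos.
exact: (IH (fun s => F (true :: s) + (-1) * F (false :: s))).
Qed.

(** A Cramer-Wold statement for sign patterns: equality in law of every linear form forces equality
    in law of the joint signs. It is [trig_same_bits] tested against the constant 1. *)
Lemma expectation_bits (ls : seq ('I_n -> R)) (F : seq bool -> R) :
  (\int[P]_w (F (map (fun a => (0 < dot a (U w))%R) ls))%:E =
   \int[P]_w (F (map (fun a => (0 < dot a (V w))%R) ls))%:E)%E.
Proof.
have [_ /(_ _ (trig_poly_cst 1))[_ _]] := trig_same_bits ls F.
by under eq_integral do rewrite mulr1; under [RHS]eq_integral do rewrite mulr1.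
Qed.

End linear_forms_law.

(** * Cyclic shifts of the Brownian bridge *)

Section rank_permutation.
Context {R : realType} (n : nat).
Implicit Types x : 'I_n.+1 -> R.

Definition rank x (r : 'I_n.+1) : nat := #|[pred m | x r < x m]|.

Lemma rank_lt x r : (rank x r < n.+1)%N.
Proof.
rewrite -[X in (_ < X)%N]card_ord /rank; apply: proper_card; apply/properP; split.
  by apply/fintype.subsetP.
by exists r; rewrite // inE ltxx.
Qed.

Lemma rank_antimono x r r' : x r < x r' -> (rank x r' < rank x r)%N.
Proof.
move=> rr'; apply: proper_card; apply/properP; split.
  by apply/fintype.subsetP => m; rewrite !inE; exact: lt_trans.
by exists r'; rewrite !inE// ltxx.
Qed.

(** Distinct values have distinct ranks, so [rank x] is a bijection onto {0, ..., n}. *)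
Lemma sum_rank x (f : nat -> R) : injective x ->
  \sum_(r < n.+1) f (rank x r) = \sum_(c < n.+1) f c.
Proof.
move=> x_inj; pose h r : 'I_n.+1 := Ordinal (rank_lt x r).
have h_inj : injective h.
  move=> r r' /(congr1 val)/= e; apply: x_inj; apply/eqP.
  by case: ltgtP => // /rank_antimono; rewrite e ltnn.
by rewrite [RHS](reindex_inj h_inj).
Qed.

End rank_permutation.

Lemma measurable_pos {R : realType} {d : measure_display} {T : measurableType d}
    (f : T -> R) : measurable_fun setT f -> measurable_fun setT (fun w => (0 < f w)%R%:R : R).
Proof.
move=> mf; have -> : (fun w => (0 < f w)%R%:R) = \1_(f @^-1` `]0, +oo[) :> (T -> R).
  apply/funext => w; rewrite indicE; congr (nat_of_bool _)%:R.
  by apply/idP/idP; rewrite inE /= in_itv/= andbT.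
by apply: measurable_indic; rewrite -[X in measurable X]setTI; exact: mf.
Qed.

(** Stated over an arbitrary measurable space so that it applies to [Omega] and also to the
    sigma-algebra generated by the bridge. *)
Lemma measurable_card_pos {R : realType} {d : measure_display} {T : measurableType d}
    (I : finType) (f : I -> T -> R) (c : nat) : (forall i, measurable_fun setT (f i)) ->
  measurable [set w | #|[pred i | 0 < f i w]| = c].
Proof.
move=> mf; pose S w : R := \sum_(i : I) (0 < f i w)%R%:R.
have SE w : S w = #|[pred i | 0 < f i w]|%:R.
  rewrite -sum1_card [in RHS]big_mkcond/= natr_sum.
  by apply: eq_bigr => i _; rewrite inE; case: ltP.
have mS : measurable_fun setT S by apply: measurable_sum => i; exact: measurable_pos.
rewrite (_ : [set _ | _] = S @^-1` [set c%:R]).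
  by rewrite -[X in measurable X]setTI; apply: mS.
apply/seteqP; split => w /=; rewrite SE; first by move=> ->.
by move/eqP; rewrite eqr_nat => /eqP.
Qed.

(** * The bridge sampled on a regular grid *)

Section bridge_grid.
Context {R : realType} {d : measure_display} {Omega : measurableType d}.
Variables (P : probability Omega R) (t : R) (B : R -> {RV P >-> R}).
Hypothesis t_gt0 : 0 < t.
Hypothesis B_bridge : brownian_bridge t B.

Definition bridge_cov (s u : R) : R := Num.min s u - s * u / t.

Lemma bridge_law (m : nat) (s a : 'I_m -> R) (A : set R) :
  (forall i, 0 <= s i <= t) -> measurable A ->
  P [set w | A (\sum_(i < m) a i * B (s i) w)] =
  normal_law 0 (\sum_(i < m) \sum_(j < m) a i * a j * bridge_cov (s i) (s j)) A.
Proof.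
move=> st mA.
have stD i : `[0, t]%classic (s i) by rewrite /= in_itv/= st.
apply: (eq_trans (bridge_gaussian B_bridge a stD mA)).
apply: (congr1 (fun m0 => normal_law m0 _ A)).
by rewrite big1// => i _; rewrite mulr0.
Qed.

(** A normal law of nonzero variance is absolutely continuous with respect to Lebesgue measure,
    which does not charge points. *)
Lemma bridge_no_atom (m : nat) (s a : 'I_m -> R) (x : R) :
  (forall i, 0 <= s i <= t) ->
  \sum_(i < m) \sum_(j < m) a i * a j * bridge_cov (s i) (s j) != 0 ->
  P [set w | \sum_(i < m) a i * B (s i) w = x] = 0%E.
Proof.
move=> st v0; have := @bridge_law m s a [set x] st (measurable_set1 x).
rewrite /normal_law (negbTE v0) => ->.
apply: (@normal_prob_dominates R _ _ [set x]) => //.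
by apply/measure0_null_setP => //; exact: lebesgue_measure_set1.
Qed.

Lemma bridge_neq0 (s : R) : 0 < s < t -> P [set w | B s w = 0] = 0%E.
Proof.
move=> /andP[s0 st].
have := @bridge_no_atom 1 (fun=> s) (fun=> 1) 0.
rewrite !big_ord_recl !big_ord0 addr0 !mul1r /bridge_cov minxx addr0 => h.
rewrite -h//; first by congr (P _); apply/seteqP; split=> w /=;
  rewrite big_ord_recl big_ord0 mul1r addr0.
- by move=> _; rewrite !ltW.
- have -> : s - s * s / t = s * (t - s) / t by field; rewrite gt_eqF.
  by rewrite !mulf_neq0 ?invr_neq0// gt_eqF// subr_gt0.
Qed.

(** The increment has variance [(u - s) * (t - (u - s)) / t], nonzero because [0 < u - s < t]. *)
Lemma bridge_neq (s u : R) : 0 <= s -> s < u -> u < t -> P [set w | B s w = B u w] = 0%E.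
Proof.
move=> s0 su ut.
have := @bridge_no_atom 2 (fun i => if i == ord0 then s else u)
  (fun i => if i == ord0 then 1 else -1) 0.
rewrite !big_ord_recl !big_ord0 /= !addr0 /bridge_cov !minxx => h.
rewrite -h//; first by congr (P _); apply/seteqP; split=> w /=;
  rewrite !big_ord_recl big_ord0/= mul1r addr0 mulN1r =>
    /eqP; rewrite ?subr_eq0 => /eqP// ->; rewrite subrr.
- by move=> i; case: ifP => _; apply/andP; split; lra.
- rewrite (min_l (ltW su)) (min_r (ltW su)).
  rewrite [X in X != 0](_ : _ = (u - s) * (t - (u - s)) / t); last by field; rewrite gt_eqF.
  by rewrite !mulf_neq0 ?invr_neq0// gt_eqF//; lra.
Qed.

(* [a] and [b] are [u + r] and [v + r] modulo [t]. *)
Lemma bridge_cov_shift (u v r a b : R) : 0 <= u < t -> 0 <= v < t -> 0 <= r < t ->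
  (a = u + r /\ u + r < t) \/ (a = u + r - t /\ t <= u + r) ->
  (b = v + r /\ v + r < t) \/ (b = v + r - t /\ t <= v + r) ->
  bridge_cov a b - bridge_cov a r - bridge_cov r b + bridge_cov r r = bridge_cov u v.
Proof.
move=> /andP[u0 ut] /andP[v0 vt] /andP[r0 rt] ha hb.
have tn0 : t != 0 by rewrite gt_eqF.
rewrite /bridge_cov minxx.
case: ha => -[-> ha]; case: hb => -[-> hb].
- rewrite (min_r (_ : r <= u + r)) ?(min_l (_ : r <= v + r)); [|lra..].
  by case: (leP u v) => uv; [rewrite min_l; last lra|rewrite min_r; last lra]; field.
- rewrite (min_r (_ : v + r - t <= u + r)) ?(min_r (_ : r <= u + r)) ?(min_r (_ : v + r - t <= r))
    ?(min_l (_ : u <= v)); [|lra..].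
  by field.
- rewrite (min_l (_ : u + r - t <= v + r)) ?(min_l (_ : u + r - t <= r)) ?(min_l (_ : r <= v + r))
    ?(min_r (_ : v <= u)); [|lra..].
  by field.
- rewrite (min_l (_ : u + r - t <= r)) ?(min_r (_ : v + r - t <= r)); [|lra..].
  by case: (leP u v) => uv; [rewrite min_l; last lra|rewrite min_r; last lra]; field.
Qed.

Variable n : nat.

(** The [n.+1] sampling times are those with [c <= n]. Larger [c] give times from [t] on, at which
    the birth process is evaluated after a shift to the right. *)
Definition grid (c : nat) : R := c%:R * t / n.+1%:R.

Lemma grid_ge0 c : 0 <= grid c.
Proof. by rewrite divr_ge0// mulr_ge0// ltW. Qed.

Lemma grid_lt c e : (c < e)%N -> grid c < grid e.
Proof. by move=> ce; rewrite ltr_pM2r ?invr_gt0// ltr_pM2r// ltr_nat. Qed.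

Lemma grid_last : grid n.+1 = t.
Proof. by rewrite /grid mulrC mulrA mulVf ?mul1r// pnatr_eq0. Qed.

Lemma grid_ltt (c : 'I_n.+1) : grid c < t.
Proof. by rewrite -[ltRHS]grid_last grid_lt. Qed.

(** Addition of ordinals is modulo [n.+1], so on the grid it is addition of times modulo [t]. *)
Lemma grid_shift (j r : 'I_n.+1) :
  (grid (j + r)%R = grid j + grid r /\ grid j + grid r < t) \/
  (grid (j + r)%R = grid j + grid r - t /\ t <= grid j + grid r).
Proof.
have gD : grid j + grid r = grid (j + r)%N by rewrite /grid natrD !mulrDl.
rewrite gD /=; have [jr|jr] := ltnP (j + r)%N n.+1.
  left; rewrite modn_small//; split => //.
  by rewrite -[ltRHS]grid_last grid_lt.
right; rewrite -[in X in _ /\ X]grid_last; split; last first.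
  by move: jr; rewrite leq_eqVlt => /predU1P[<-//|/grid_lt/ltW].
have -> : ((j + r) %% n.+1 = j + r - n.+1)%N.
  rewrite -{1}(subnK jr) modnDr modn_small//.
  by have := ltn_ord j; have := ltn_ord r; lia.
by rewrite -[X in _ - X]grid_last /grid natrB// !mulrBl.
Qed.

Definition bridge_samples (w : Omega) (j : 'I_n.+1) : R := B (grid j) w.

Definition shifted_samples (r : 'I_n.+1) (w : Omega) (j : 'I_n.+1) : R :=
  B (grid (j + r)%R) w - B (grid r) w.

(** Linear forms in either family are linear combinations of bridge values, hence centred Gaussian;
    by [bridge_cov_shift] their variances agree. *)
Lemma shifted_samples_law r (a : 'I_n.+1 -> R) (A : set R) : measurable A ->
  P [set w | A (dot a (bridge_samples w))] = P [set w | A (dot a (shifted_samples r w))].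
Proof.
move=> mA.
have gt0 j : 0 <= grid j by exact: grid_ge0.
have gtt (j : 'I_n.+1) : grid j <= t by exact/ltW/grid_ltt.
have stg (j : 'I_n.+1) : 0 <= grid j <= t by rewrite gt0 gtt.
rewrite /dot /bridge_samples.
apply: (eq_trans (bridge_law a stg mA)); apply: esym.
(* Index 0 carries the subtracted value B(grid r). *)
pose s' (i : 'I_n.+2) := if unlift ord0 i is Some j then grid (j + r)%R else grid r.
pose a' (i : 'I_n.+2) := if unlift ord0 i is Some j then a j else - \sum_(j < n.+1) a j.
have sumE (f : R -> R) : \sum_(i < n.+2) a' i * f (s' i) =
    \sum_(j < n.+1) a j * (f (grid (j + r)%R) - f (grid r)).
  under [RHS]eq_bigr do rewrite mulrBr.
  rewrite big_ord_recl sumrB -mulr_suml -mulNr addrC; congr (_ + _).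
    by apply: eq_bigr => j _; rewrite /a' /s' liftK.
  by rewrite /a' /s' unlift_none.
have -> : [set w | A (\sum_(i < n.+1) a i * shifted_samples r w i)] =
    [set w | A (\sum_(i < n.+2) a' i * B (s' i) w)].
  by apply/funext => w /=; rewrite (sumE (fun s => B s w)).
have sts' i : 0 <= s' i <= t.
  by rewrite /s'; case: unliftP => [j _|_]; rewrite gt0 gtt.
apply: (eq_trans (bridge_law a' sts' mA)); apply: (congr1 (fun v => normal_law 0 v A)); apply: esym.
(* [sumE] is applied in each argument of the covariance, turning the double sum over [n.+2] indices
   into one over increments. *)
under [RHS]eq_bigr => i _.
  under eq_bigr do rewrite -mulrA.
  rewrite -mulr_sumr (sumE (fun s => bridge_cov (s' i) s)); over.
rewrite (sumE (fun u => \sum_(j < n.+1)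
  a j * (bridge_cov u (grid (j + r)%R) - bridge_cov u (grid r)))).
apply: eq_bigr => i _; rewrite -sumrB mulr_sumr; apply: eq_bigr => j _.
rewrite -mulrA -mulrBr; congr (_ * (_ * _)).
rewrite -(@bridge_cov_shift (grid i) (grid j) (grid r) (grid (i + r)%R) (grid (j + r)%R)).
- by ring.
- by rewrite gt0 grid_ltt.
- by rewrite gt0 grid_ltt.
- by rewrite gt0 grid_ltt.
- exact: grid_shift.
- exact: grid_shift.
Qed.

Definition positive_count (w : Omega) : nat := #|[pred j : 'I_n.+1 | 0 < B (grid j) w]|.

(** By shift invariance the count has the law of the number of positive differences between the
    samples and sample [r], which is the rank of sample [r]. *)
Lemma expectation_positive_count (f : nat -> R) r :
  (\int[P]_w (f (positive_count w))%:E =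
   \int[P]_w (f (rank (bridge_samples w) r))%:E)%E.
Proof.
(* Pairing with the coordinate vector [e j] reads off sample [j], so the count is the number of true
   bits. *)
pose e (j : 'I_n.+1) : 'I_n.+1 -> R := fun i => (i == j)%:R.
have dot_e j x : dot (e j) x = x j.
  rewrite /dot (bigD1 j)//= /e eqxx mul1r big1 ?addr0// => i /negbTE->.
  by rewrite mul0r.
have mS : forall j, measurable_fun setT (bridge_samples ^~ j).
  by move=> j; exact: measurable_funP.
have mS' : forall j, measurable_fun setT (shifted_samples r ^~ j).
  by move=> j; apply: measurable_funB; exact: measurable_funP.
have := expectation_bits mS mS' (shifted_samples_law r) [seq e j | j <- enum 'I_n.+1]
  (fun s => f (count id s)).
have cntE (x : 'I_n.+1 -> R) :
    count id [seq (0 < dot a x)%R | a <- [seq e j | j <- enum 'I_n.+1]] =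
    #|[pred j | 0 < x j]|.
  rewrite !count_map cardE /enum_mem -enumT size_filter.
  by apply: eq_count => j /=; rewrite dot_e.
under eq_integral do rewrite cntE.
under [X in _ = X -> _]eq_integral do rewrite cntE.
move=> ->; apply: eq_integral => w _; congr ((f _)%:E).
(* Translation by [r] is a bijection of the cyclic group of indices. *)
rewrite /rank -(fintype.card_image (@addIr _ r)).
apply: eq_card => m; rewrite !inE; apply/fintype.imageP/idP => [[j]|xm].
  by rewrite inE => + ->; rewrite subr_gt0.
exists (m - r); last by rewrite subrK.
by rewrite inE /shifted_samples subrK subr_gt0.
Qed.

Lemma bridge_samples_injective : \forall w \ae P, injective (bridge_samples w).
Proof.
have neq (i j : 'I_n.+1) : \forall w \ae P, i != j -> bridge_samples w i <> bridge_samples w j.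
  wlog ij : i j / (i < j)%N => [wl|].
    have [ij|ij|/val_inj ->] := ltngtP i j; first exact: wl.
      have := wl j i ij; apply: filterS => w + ji => /(_ _)/[swap] e; apply.
        by rewrite eq_sym.
      exact/esym.
    by apply: filterE => w; rewrite eqxx.
  exists [set w | B (grid i) w = B (grid j) w]; split.
  - rewrite (_ : [set _ | _] = (fun w => B (grid i) w - B (grid j) w) @^-1` [set 0]).
      rewrite -[X in measurable X]setTI.
      apply: (measurable_funB (measurable_funP _) (measurable_funP _)) => //.
    by apply/funext => w /=; rewrite propeqE; split => [->|/eqP]; rewrite ?subrr// subr_eq0 => /eqP.
  - by apply: bridge_neq; [exact: grid_ge0|exact: grid_lt|exact: grid_ltt].
  - by move=> w /=; apply: contra_notP => h _.
have neqA : \forall w \ae P, forall i j : 'I_n.+1,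
    i != j -> bridge_samples w i <> bridge_samples w j.
  by apply: filter_forall => i; apply: filter_forall => j; exact: neq.
apply: filterS neqA => w h i j xij; apply/eqP/negPn/negP => ij.
exact: (h i j).
Qed.

Lemma measurable_positive_count c : measurable [set w | positive_count w = c].
Proof.
apply: (@measurable_card_pos _ _ _ 'I_n.+1 (fun j w => B (grid j) w) c) => j.
exact: measurable_funP.
Qed.

Lemma measurable_rank r c : measurable [set w | rank (bridge_samples w) r = c].
Proof.
have := @measurable_card_pos _ _ _ 'I_n.+1 (fun j w => B (grid j) w - B (grid r) w) c
  (fun j => measurable_funB (measurable_funP _) (measurable_funP _)).
congr (measurable _); apply/funext => w; congr (_ = c).
by apply: eq_card => j; rewrite !inE subr_gt0.
Qed.

(** The bound is not strict: the value [n.+1] is excluded only almost surely, by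
    [positive_count_law]. *)
Lemma positive_count_lt w : (positive_count w <= n.+1)%N.
Proof. by rewrite -[leqRHS]card_ord; exact: max_card. Qed.

(** Sum [expectation_positive_count] over the [n.+1] shifts: almost surely the ranks exhaust {0,
    ..., n}, so exactly one shift has rank [c] if [c <= n], and none otherwise. *)
Lemma positive_count_law (c : nat) :
  P [set w | positive_count w = c] = ((c < n.+1)%N%:R / n.+1%:R)%:E.
Proof.
pose f (i : nat) : R := (i == c)%:R.
have f01 i : `|f i| <= 1 by rewrite /f; case: eqP => _; rewrite ?normr1 ?normr0.
have fE (h : Omega -> nat) w : \1_[set w | h w = c] w = f (h w) :> R.
  by rewrite indicE /f; congr (nat_of_bool _)%:R; apply/idP/eqP; rewrite inE.
have mrank r : measurable_fun setT (fun w => f (rank (bridge_samples w) r)).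
  under eq_fun do rewrite -(fE (fun w => rank (bridge_samples w) r)).
  exact/measurable_indic/measurable_rank.
have irank r : P.-integrable setT (fun w => (f (rank (bridge_samples w) r))%:E).
  exact: (bounded_integrable P (mrank r) (fun w => f01 _)).
set p := P _; have pE : p = (\int[P]_w (f (positive_count w))%:E)%E.
  under eq_integral do rewrite -(fE positive_count).
  by rewrite integral_indic// ?setIT//; exact: measurable_positive_count.
have sump : (n.+1%:R%:E * p = (c < n.+1)%N%:R%:E)%E.
  transitivity (\sum_(r < n.+1) \int[P]_w (f (rank (bridge_samples w) r))%:E)%E.
    under eq_bigr do rewrite -expectation_positive_count -pE.
    have -> : p = (fine p)%:E.
      by rewrite fineK// fin_num_measure//; exact: measurable_positive_count.
    by rewrite sumEFin sumr_const card_ord -EFinM mulr_natl.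
  rewrite -integral_sum//.
  transitivity (\int[P]_w (cst (c < n.+1)%N%:R%:E w))%E; last first.
    rewrite integral_cst// [X in (_ * X)%E](_ : _ = 1%E) ?mule1//.
    exact: probability_setT.
  apply: ae_eq_integral => //.
    by apply: emeasurable_sum => r; exact/measurable_EFinP.
  apply: filterS bridge_samples_injective => w w_inj _.
  rewrite sumEFin (sum_rank f w_inj) /f /cst; congr (_%:E).
  have [cn|cn] := ltnP c n.+1; last first.
    by rewrite big1// => i _; rewrite ltn_eqF// (leq_trans (ltn_ord i)).
  rewrite (bigD1 (Ordinal cn))//= eqxx big1 ?addr0// => i.
  by rewrite -val_eqE /= => /negbTE->.
rewrite mulrC EFinM -sump muleA -EFinM mulVf ?mul1e//.
Qed.

End bridge_grid.

(** * The sojourn time as a limit of counts *)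

Lemma measurable_fun_EFin {R : realType} {d : measure_display} {T : measurableType d}
  (f : T -> R) : measurable_fun setT f -> measurable_fun setT (fun x => (f x)%:E).
Proof. by move=> mf; exact/measurable_EFinP. Qed.

Section occupation_time.
Context {R : realType} {d : measure_display} {Omega : measurableType d}.
Variables (P : probability Omega R) (t : R) (B : R -> {RV P >-> R}).
Hypothesis t_gt0 : 0 < t.
Hypothesis B_bridge : brownian_bridge t B.

(** Half-open, so that the cells with [j <= n] partition [0, t). *)
Let cell n j : set R := `[grid t n j, grid t n j.+1[%classic.

Lemma grid_cell n (s : R) : 0 <= s < t -> exists j : 'I_n.+1, cell n j s.
Proof.
move=> /andP[s0 st].
have n0 : 0 < n.+1%:R :> R by rewrite ltr0n.
have sn0 : 0 <= s * n.+1%:R / t by rewrite divr_ge0 ?mulr_ge0// ltW.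
have := truncn_itv sn0.
set m := Num.truncn _; move=> /andP[]; rewrite ler_pdivlMr// ltr_pdivrMr// => mle mlt.
have mn : (m < n.+1)%N.
  rewrite -(ltr_nat R) -(ltr_pM2r t_gt0) (le_lt_trans mle)//.
  by rewrite mulrC ltr_pM2l.
exists (Ordinal mn); rewrite /cell /= in_itv/= /grid.
by rewrite ler_pdivrMr// ltr_pdivlMr// mle mlt.
Qed.

Lemma cell_uniq n (i j : nat) (s : R) : cell n i s -> cell n j s -> i = j.
Proof.
rewrite /cell /= !in_itv/= => /andP[i1 i2] /andP[j1 j2].
apply/eqP; case: ltngtP => // ij.
- have : grid t n i.+1 <= grid t n j.
    by move: ij; rewrite leq_eqVlt => /predU1P[->//|ij]; rewrite ltW// grid_lt.
  by lra.
- have : grid t n j.+1 <= grid t n i.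
    by move: ij; rewrite leq_eqVlt => /predU1P[->//|ij]; rewrite ltW// grid_lt.
  by lra.
Qed.

Lemma cell_sub n (j : 'I_n.+1) (s : R) : cell n j s -> 0 <= s < t.
Proof.
rewrite /cell /= in_itv/= => /andP[j1 j2].
rewrite (le_trans (grid_ge0 t_gt0 n j) j1) (lt_le_trans j2)//.
rewrite -[leRHS](@grid_last _ t n); have := ltn_ord j; rewrite leq_eqVlt => /predU1P[->//|jn].
by rewrite ltW// grid_lt.
Qed.

Lemma sum_cell n (f : 'I_n.+1 -> R) (s : R) (j : 'I_n.+1) : cell n j s ->
  \sum_(i < n.+1) \1_(cell n i) s * f i = f j.
Proof.
move=> js; rewrite (bigD1 j)//= indicE mem_set// mul1r big1 ?addr0// => i ij.
rewrite indicE memNset ?mul0r// => /cell_uniq /(_ js)/val_inj e.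
by rewrite e eqxx in ij.
Qed.

Lemma sum_cell_out n (f : 'I_n.+1 -> R) (s : R) : ~~ (0 <= s < t) ->
  \sum_(i < n.+1) \1_(cell n i) s * f i = 0.
Proof.
move=> st; rewrite big1// => i _.
by rewrite indicE memNset ?mul0r// => /cell_sub; exact/negP.
Qed.

(** Sampling at the left end of each cell makes joint measurability in time and [w] immediate. *)
Definition step_bridge n (z : R * Omega) : R :=
  \sum_(j < n.+1) \1_(cell n j) z.1 * B (grid t n j) z.2.

Definition windowed_bridge (z : R * Omega) : R := \1_(`[0, t[) z.1 * B z.1 z.2.

Lemma pos_step_bridge n (s : R) w : (0 < step_bridge n (s, w))%R%:R =
  \sum_(j < n.+1) \1_(cell n j) s * (0 < B (grid t n j) w)%R%:R :> R.
Proof.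
have [st|st] := boolP (0 <= s < t); last by rewrite /step_bridge !sum_cell_out// ltxx.
have [j js] := grid_cell n st.
by rewrite /step_bridge/= (sum_cell (fun i => B (grid t n i) w) js)
  (sum_cell (fun i => (0 < B (grid t n i) w)%R%:R) js).
Qed.

Lemma measurable_step_bridge n : measurable_fun setT (step_bridge n).
Proof.
apply: measurable_sum => j; apply: measurable_funM.
  have m1 : measurable_fun setT (\1_(cell n j) : R -> R).
    by apply: measurable_indic; exact: measurable_itv.
  exact: (measurableT_comp m1 measurable_fst).
exact: (measurableT_comp (measurable_funP (B (grid t n j))) measurable_snd).
Qed.

Lemma step_bridge_cvg z : step_bridge n z @[n --> \oo] --> windowed_bridge z.
Proof.
case: z => s w; rewrite /step_bridge /windowed_bridge /=.
have [st|st] := boolP (0 <= s < t); last first.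
  under eq_cvg do rewrite sum_cell_out//.
  rewrite indicE memNset ?mul0r; first exact: cvg_cst.
  by rewrite /= in_itv/=; exact/negP.
rewrite indicE mem_set ?mul1r; last by rewrite /= in_itv.
have cB : {within `[0, t], continuous (fun s : R => B s w)}.
  by apply: (bridge_continuous B_bridge).
have sI : `[0, t]%classic s by rewrite /= in_itv/=; have /andP[-> /ltW] := st.
have /cvgrPdist_lt cBs := (subspace_continuousP _ _).1 cB s sI.
apply/cvgrPdist_lt => e e0; have := cBs e e0.
rewrite near_withinE /= => /nbhs_ballP[r /= r0 hr].
near=> n; have [j js] := grid_cell n st.
rewrite (sum_cell (fun i => B (grid t n i) w) js).
apply: hr.
- rewrite /ball/=; move: js; rewrite /cell /= in_itv/= => /andP[j1 j2].
  rewrite ger0_norm ?subr_ge0//.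
  have -> : s - grid t n j < r; last by [].
  rewrite (@lt_trans _ _ (grid t n j.+1 - grid t n j))// ?ltrD2r//.
  rewrite /grid -mulrBl -mulrBl -natrB// subSnn mul1r.
  near: n; exists (Num.truncn (t / r)).+1 => // m /= tm.
  rewrite ltr_pdivrMr// mulrC -ltr_pdivrMr// (lt_le_trans (truncnS_gt _))// ler_nat.
  exact: leqW.
- rewrite /= in_itv/= grid_ge0//= ltW//.
  exact: grid_ltt.
Unshelve. all: by end_near. Qed.

(** Each [B s] is given as measurable in [w] only; joint measurability, required by Tonelli, comes
    from path continuity through the limit of the step processes. *)
Lemma measurable_windowed_bridge : measurable_fun setT windowed_bridge.
Proof.
apply: (measurable_fun_cvg (h := step_bridge)) => [n|z _].
  exact: measurable_step_bridge.
exact: step_bridge_cvg.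
Qed.

(** Indicator of [0 <= s < t] and [0 <= B s w], expressed by a strict inequality so that
    [measurable_pos] applies. *)
Definition occupation (z : R * Omega) : R :=
  \1_(`[0, t[) z.1 - (0 < - windowed_bridge z)%R%:R.

Lemma occupationE (s : R) w : occupation (s, w) =
  if 0 <= s < t then \1_(`[0, +oo[) (B s w) else 0.
Proof.
rewrite /occupation /windowed_bridge /=; have [st|st] := boolP (0 <= s < t).
  rewrite indicE mem_set/= ?in_itv//= mul1r indicE oppr_gt0 ltNge.
  have -> : (B s w \in `[0, +oo[%classic) = (0 <= B s w).
    by apply/idP/idP; rewrite inE/= in_itv/= andbT.
  by case: (0 <= B s w); rewrite ?subr0 ?subrr.
rewrite indicE memNset/= ?in_itv/=; last exact/negP.
by rewrite mul0r oppr0 ltxx subr0.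
Qed.

Lemma measurable_occupation : measurable_fun setT occupation.
Proof.
apply: measurable_funB.
  have m1 : measurable_fun setT (\1_(`[0, t[) : R -> R).
    by apply: measurable_indic; exact: measurable_itv.
  exact: (measurableT_comp m1 measurable_fst).
by apply: measurable_pos; apply: measurableT_comp => //; exact: measurable_windowed_bridge.
Qed.

Definition occupation_gap n (z : R * Omega) : R :=
  `|(0 < step_bridge n z)%R%:R - occupation z|.

Lemma measurable_occupation_gap n : measurable_fun setT (occupation_gap n).
Proof.
apply: measurableT_comp => //; apply: measurable_funB.
  by apply: measurable_pos; exact: measurable_step_bridge.
exact: measurable_occupation.
Qed.

Lemma occupation_gap_bounds n (s : R) w : 0 <= occupation_gap n (s, w) <= \1_(`[0, t[) s.
Proof.
rewrite /occupation_gap normr_ge0/= occupationE.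
have [st|st] := boolP (0 <= s < t).
  rewrite [leRHS]indicE mem_set/= ?in_itv//= [\1_ _ _]indicE.
  by case: (0 < _); case: (_ \in _); rewrite /= ?subrr ?subr0 ?sub0r ?normrN ?normr1 ?normr0 ?ler01.
by rewrite /step_bridge sum_cell_out// ltxx subr0 normr0 indicE; case: (_ \in _).
Qed.

(** Where the path is nonzero, the step process eventually has the sign of [B s w], and strict and
    weak positivity agree. *)
Lemma occupation_gap_cvg (s : R) w : (0 <= s < t -> B s w != 0) ->
  occupation_gap n (s, w) @[n --> \oo] --> (0 : R).
Proof.
move=> Bs0; have [st|st] := boolP (0 <= s < t); last first.
  have -> : (fun n => occupation_gap n (s, w)) = cst 0.
    apply/funext => n; have := occupation_gap_bounds n s w.
    rewrite indicE memNset/= ?in_itv/=; last exact/negP.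
    by rewrite -eq_le => /eqP.
  exact: cvg_cst.
have B0 := Bs0 st; have := @step_bridge_cvg (s, w).
have -> : windowed_bridge (s, w) = B s w.
  by rewrite /windowed_bridge/= indicE mem_set ?mul1r//= in_itv.
move=> /cvgrPdist_lt/(_ `|B s w|); rewrite normr_gt0 => /(_ B0) near_B.
apply: (@cvg_trans _ (cst (0 : R) @ \oo)); last exact: cvg_cst.
apply: near_eq_cvg; apply: filterS near_B => n Bn /=.
rewrite /occupation_gap occupationE st indicE.
have -> : (B s w \in `[0, +oo[%classic) = (0 <= B s w).
  by apply/idP/idP; rewrite inE/= in_itv/= andbT.
suff -> : (0 < step_bridge n (s, w)) = (0 <= B s w) by rewrite subrr normr0.
have [B1|B1|B1] := ltgtP (B s w) 0; last by rewrite B1 eqxx in B0.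
- move: Bn; rewrite (ltr0_norm B1) ltr_norml => /andP[h _].
  by apply/negbTE; rewrite -leNgt; lra.
- by move: Bn; rewrite (gtr0_norm B1) ltr_norml => /andP[_ h]; lra.
Qed.

Local Notation mu := (@lebesgue_measure R).

(** At a fixed time inside (0, t) the bridge is almost surely nonzero. Time 0 is excluded because
    the variance is zero there. *)
Lemma occupation_gap_expectation_cvg (s : R) : s != 0 ->
  (\int[P]_w (occupation_gap n (s, w))%:E @[n --> \oo] --> 0)%E.
Proof.
move=> s0.
have gap01 n w : `|occupation_gap n (s, w)| <= 1.
  have /andP[g0 g1] := occupation_gap_bounds n s w.
  by rewrite ger0_norm// (le_trans g1)// indicE; case: (_ \in _).
have -> : (0 = \int[P]_w (cst (0 : R) w)%:E)%E by rewrite integral0.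
apply: (@bounded_cvg_integral _ _ _ P (fun n w => occupation_gap n (s, w)) (cst 0) 1) => //.
  move=> n; apply: (measurableT_comp (measurable_occupation_gap n)).
  exact: measurable_pair1.
have [st|st] := boolP (0 <= s < t); last first.
  apply: filterE => w; apply: occupation_gap_cvg => st'.
  by rewrite st' in st.
exists [set w | B s w = 0]; split.
- rewrite -[X in measurable X]setTI.
  have mB : measurable_fun setT (B s) by exact: measurable_funP.
  exact: (mB measurableT _ (measurable_set1 (0 : R))).
- apply: (bridge_neq0 t_gt0 B_bridge).
  by rewrite lt_neqAle eq_sym s0/= st.
- move=> w /=; apply: contra_notP => /eqP B0.
  exact: occupation_gap_cvg.
Qed.

Let integrable_window : mu.-integrable setT (fun s : R => (\1_(`[0, t[) s : R)%:E).
Proof. exact: (integrable_indic_itv 0 t true true). Qed.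

Let bounded_window (f : R -> R) : measurable_fun setT f ->
  (forall s, 0 <= f s <= \1_(`[0, t[) s) -> mu.-integrable setT (EFin \o f).
Proof.
move=> mf f01; apply: (le_integrable measurableT _ _ integrable_window).
  exact/measurable_EFinP.
move=> s _ /=; rewrite lee_fin; have /andP[f0 f1] := f01 s.
by rewrite !ger0_norm// (le_trans f0).
Qed.

(** Tonelli puts the time integral outside, so that only fixed times matter and not the zero set of
    a single path. The window indicator dominates, and the exceptional time 0 is a null set. *)
Lemma occupation_gap_integral_cvg :
  (\int[P]_w \int[mu]_s (occupation_gap n (s, w))%:E @[n --> \oo] --> 0)%E.
Proof.
have gap0 n z : (0 <= (occupation_gap n z)%:E)%E by rewrite lee_fin normr_ge0.
have mgap n : measurable_fun setT (EFin \o occupation_gap n).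
  by apply/measurable_EFinP; exact: measurable_occupation_gap.
under eq_cvg => n do rewrite -(@fubini_tonelli _ _ _ _ _ mu P _ (mgap n) (gap0 n)).
have := @dominated_convergence _ _ _ mu setT measurableT
  (fun n s => \int[P]_w (occupation_gap n (s, w))%:E)%E (cst 0%E)
  (fun s => (\1_(`[0, t[) s)%:E).
case.
- by move=> n; exact: (measurable_fun_fubini_tonelli_F _ (mgap n) (gap0 n)).
- exact: measurable_cst.
- exists [set 0]; split => //; first exact: lebesgue_measure_set1.
  move=> s /=; apply: contra_notP => /eqP s0 _.
  exact: occupation_gap_expectation_cvg.
- exact: integrable_window.
- apply: filterE => s n _.
  rewrite gee0_abs; last by apply: integral_ge0 => w _; exact: gap0.
  rewrite -[leRHS]mule1 -[X in (_ * X)%E](@probability_setT _ _ _ P) -integral_cst//.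
  apply: ge0_le_integral => //.
  + exact: (measurableT_comp (mgap n) (measurable_pair1 s)).
  + by move=> w _; rewrite /cst lee_fin; have /andP[] := occupation_gap_bounds n s w.
- by move=> _ _; rewrite integral0; exact.
Qed.

Let measurable_section (f : R * Omega -> R) w : measurable_fun setT f ->
  measurable_fun setT (fun s => f (s, w)).
Proof. by move=> mf; exact: (measurableT_comp mf (measurable_pair2 w)). Qed.

(** Each cell has length [t / n.+1] and contributes fully or not at all, according to the sign at
    its left end. *)
Lemma integral_pos_step_bridge n w :
  (\int[mu]_s ((0 < step_bridge n (s, w))%R%:R : R)%:E =
   ((positive_count t B n w)%:R * t / n.+1%:R)%:E)%E.
Proof.
under eq_integral do rewrite pos_step_bridge -sumEFin.
have mcell j : measurable_fun setT (\1_(cell n j) : R -> R).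
  by apply: measurable_indic; exact: measurable_itv.
have mterm (j : 'I_n.+1) : measurable_fun setT
    (fun s => (\1_(cell n j) s * (0 < B (grid t n j) w)%R%:R : R)%:E).
  apply: measurable_fun_EFin; apply: measurable_funM; first exact: mcell.
  exact: measurable_cst.
have term0 (j : 'I_n.+1) s :
    (0 <= (\1_(cell n j) s * (0 < B (grid t n j) w)%R%:R : R)%:E)%E.
  by rewrite lee_fin mulr_ge0// indicE.
rewrite (ge0_integral_sum mu measurableT mterm (fun j s _ => term0 j s)).
transitivity (\sum_(j < n.+1) ((0 < B (grid t n j) w)%R%:R * (t / n.+1%:R) : R)%:E)%E.
  apply: eq_bigr => j _; under eq_integral do rewrite mulrC EFinM.
  rewrite ge0_integralZl_EFin//; last first.
    by apply: measurable_fun_EFin; exact: mcell.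
  rewrite integral_indic//=; last exact: measurable_itv.
  rewrite setIT /cell lebesgue_measure_itv/= lte_fin grid_lt// -EFinD -EFinM.
  by rewrite /grid -!mulrBl -natrB// subSnn mul1r.
rewrite sumEFin -mulr_suml mulrA; congr (_ * _ / _)%:E.
by rewrite /positive_count -sum1_card [in RHS]big_mkcond/= natr_sum;
  apply: eq_bigr => j _; rewrite inE; case: ltP.
Qed.

Let occupation_bounds s w : 0 <= occupation (s, w) <= \1_(`[0, t[) s.
Proof.
rewrite occupationE; case: ifP => st; last by rewrite lexx/= ?indicE.
rewrite (_ : \1_(`[0, t[) s = 1); last by rewrite indicE mem_set//= in_itv.
by rewrite indicE; case: (_ \in _); rewrite ?lexx ler01.
Qed.

Lemma sojourn_timeE w : (sojourn_time t B w)%:E = (\int[mu]_s (occupation (s, w))%:E)%E.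
Proof.
have mocc := measurable_section w measurable_occupation.
have iocc := bounded_window mocc (fun s => occupation_bounds s w).
have -> : (\int[mu]_s (occupation (s, w))%:E =
    \int[mu]_(s in `[0%R, t[) (\1_(`[0, +oo[) (B s w) : R)%:E)%E.
  rewrite [RHS]integral_mkcond; apply: eq_integral => s _.
  rewrite patchE occupationE; case: ifPn => st; first by rewrite mem_set//= in_itv.
  by rewrite memNset//= in_itv/=; exact/negP.
have mB : measurable_fun `[0, t[ (fun s => \1_(`[0, +oo[) (B s w) : R).
  apply: (@eq_measurable_fun _ _ _ _ _ (fun s => occupation (s, w))).
    by move=> s; rewrite inE/= in_itv/= occupationE => ->.
  exact: measurable_funTS.
have mEB : measurable_fun `[0, t[ (fun s => (\1_(`[0, +oo[) (B s w) : R)%:E).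
  exact/measurable_EFinP.
have itvE := integral_itv_bndo_bndc mEB.
rewrite /sojourn_time /Rintegral itvE fineK// -itvE.
(* The real-valued integral is the [fine] part of the extended one, which is 0 on infinite values;
   hence finiteness is checked. *)
rewrite ge0_fin_numE; last by apply: integral_ge0 => s _; rewrite lee_fin.
apply: (@le_lt_trans _ _ (\int[mu]_(s in `[0%R, t[) (cst 1%E s))%E).
  apply: ge0_le_integral => //.
  by move=> s _; rewrite lee_fin indicE; case: (_ \in _).
by rewrite integral_cst//= mul1e lebesgue_measure_itv/= lte_fin t_gt0 ltry.
Qed.

Lemma measurable_sojourn_time : measurable_fun setT (sojourn_time t B).
Proof.
have mocc : measurable_fun setT (EFin \o occupation).
  by apply/measurable_EFinP; exact: measurable_occupation.
have occ0 z : (0 <= (occupation z)%:E)%E.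
  by case: z => s w; rewrite lee_fin; have /andP[] := occupation_bounds s w.
apply/measurable_EFinP; rewrite /comp.
under eq_fun do rewrite sojourn_timeE.
exact: (@measurable_fun_fubini_tonelli_G _ _ _ _ _ mu _ mocc occ0).
Qed.

Lemma sojourn_time_ge0 w : 0 <= sojourn_time t B w.
Proof.
rewrite -lee_fin sojourn_timeE; apply: integral_ge0 => s _; rewrite lee_fin.
by have /andP[] := occupation_bounds s w.
Qed.

Lemma sojourn_time_approx n w :
  (`|(positive_count t B n w)%:R * t / n.+1%:R - sojourn_time t B w|%:E <=
   \int[mu]_s (occupation_gap n (s, w))%:E)%E.
Proof.
rewrite -abse_EFin EFinB sojourn_timeE -integral_pos_step_bridge.
have mstep := measurable_section w (measurable_pos (measurable_step_bridge n)).
have mocc := measurable_section w measurable_occupation.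
have istep : mu.-integrable setT (fun s => ((0 < step_bridge n (s, w))%R%:R : R)%:E).
  apply: (bounded_window mstep) => s; rewrite ler0n/= pos_step_bridge.
  have [st|st] := boolP (0 <= s < t); last by rewrite sum_cell_out// indicE.
  have [j js] := grid_cell n st.
  by rewrite (sum_cell _ js) indicE mem_set/= ?in_itv//=; case: (0 < _); rewrite ?ler01.
rewrite -integralB_EFin//; last first.
  exact: (bounded_window mocc (fun s => occupation_bounds s w)).
apply: (le_trans (le_abse_integral _ _ _)) => //.
by apply: emeasurable_funB; exact: measurable_fun_EFin.
Qed.

Definition count_error n w : R :=
  (positive_count t B n w)%:R * t / n.+1%:R - sojourn_time t B w.

Lemma measurable_far_count_error n (e : R) : measurable [set w | e <= `|count_error n w|].
Proof.
have mcount : measurable_fun setT (fun w => (positive_count t B n w)%:R : R).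
  rewrite (_ : (fun w => _) = fun w => \sum_(j < n.+1) ((0 < B (grid t n j) w)%R%:R : R)).
    by apply: measurable_sum => j; apply: measurable_pos; exact: measurable_funP.
  apply/funext => w; rewrite /positive_count -sum1_card big_mkcond/= natr_sum.
  by apply: eq_bigr => j _; rewrite inE; case: ltP.
have merr : measurable_fun setT (fun w => `|count_error n w|).
  apply: measurableT_comp => //; apply: measurable_funB; last exact: measurable_sojourn_time.
  apply: measurable_funM; last exact: measurable_cst.
  by apply: measurable_funM; last exact: measurable_cst.
rewrite (_ : [set _ | _] = (fun w => `|count_error n w|) @^-1` `[e, +oo[).
  by rewrite -[X in measurable X]setTI; apply: merr => //; exact: measurable_itv.
by apply/seteqP; split => w /=; rewrite in_itv/= andbT.
Qed.

(** Markov's inequality for the time integral of the gap: it bounds the count error by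
    [sojourn_time_approx], and its expectation tends to 0. *)
Lemma positive_count_cvg_sojourn_time (e : R) : 0 < e ->
  (P [set w | (e <= `|count_error n w|)%R] @[n --> \oo] --> 0)%E.
Proof.
move=> e0; pose A n := [set w | e <= `|count_error n w|].
pose Y n w := (\int[mu]_s (occupation_gap n (s, w))%:E)%E.
have mA n : measurable (A n) by exact: measurable_far_count_error.
have mgap n : measurable_fun setT (EFin \o occupation_gap n).
  by apply/measurable_EFinP; exact: measurable_occupation_gap.
have gap0 n z : (0 <= (occupation_gap n z)%:E)%E by rewrite lee_fin normr_ge0.
have Y0 n w : (0 <= Y n w)%E by apply: integral_ge0.
have mY n : measurable_fun setT (Y n).
  exact: (@measurable_fun_fubini_tonelli_G _ _ _ _ _ mu _ (mgap n) (gap0 n)).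
have cY : ((e^-1)%:E * \int[P]_w Y n w @[n --> \oo] --> 0)%E.
  rewrite -[X in _ --> X](mule0 (e^-1)%:E); apply: cvgeZl => //.
  exact: occupation_gap_integral_cvg.
apply: (squeeze_cvge _ (cvg_cst _) cY); apply: nearW => n.
rewrite measure_ge0/= lee_pdivlMl// -/(A n) -(setIT (A n)) -integral_indic//.
have mind : measurable_fun setT (fun w => (\1_(A n) w : R)%:E).
  by apply: measurable_fun_EFin; exact: measurable_indic.
have ind0 w : (0 <= (\1_(A n) w : R)%:E)%E by rewrite lee_fin indicE.
rewrite -(ge0_integralZl_EFin P measurableT (fun w _ => ind0 w) mind (ltW e0)).
apply: ge0_le_integral => //.
- by move=> w _; rewrite mule_ge0// lee_fin ltW.
- exact: measurable_funeM.
- move=> w _; rewrite indicE; have [wA|wA] := boolP (w \in A n); last by rewrite mule0.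
  rewrite mule1 (le_trans _ (sojourn_time_approx n w))// lee_fin.
  by move: wA; rewrite inE.
Qed.

End occupation_time.

(** * The birth process at the sojourn time *)

Section process_sigma_events.
Context {R : realType} {d : measure_display} {Omega : measurableType d}.
Variable P : probability Omega R.

Lemma process_sigma_preimage {d'} {S : measurableType d'} (D : set R)
    (X : R -> {RV P >-> S}) (s : R) (A : set S) :
  D s -> measurable A -> process_sigma D X [set w | A (X s w)].
Proof.
move=> Ds mA; apply: sub_gen_smallest; exists s => //.
by exists A => //; rewrite setTI.
Qed.

(** Independence speaks of events of the generated sigma-algebra, so the count must be measurable
    there and not only in [Omega]. *)
Lemma process_sigma_positive_count (t : R) (B : R -> {RV P >-> R}) (n c : nat) :
  0 < t -> process_sigma `[0, t] B [set w | positive_count t B n w = c].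
Proof.
move=> t0.
pose G := \bigcup_(r in `[0, t]%classic) preimage_set_system [set: Omega] (B r) measurable.
apply: (@measurable_card_pos R _ (g_sigma_algebraType G) 'I_n.+1
  (fun j w => B (grid t n j) w) c) => j.
move=> _ A mA; rewrite setTI; apply: process_sigma_preimage => //.
by rewrite /= in_itv/= grid_ge0//= ltW// grid_ltt.
Qed.

End process_sigma_events.

Section shifted_sums.
Context {R : realType}.
Variable F : nat -> R.
Hypothesis F01 : forall c, 0 <= F c <= 1.

Let sum_ub m n : \sum_(m <= c < n) F c <= (n - m)%:R.
Proof.
rewrite -(@sumr_const_nat R n m 1); apply: ler_sum => c _.
by have /andP[] := F01 c.
Qed.

Let sum_ge0 m n : 0 <= \sum_(m <= c < n) F c.
Proof. by apply: sumr_ge0 => c _; have /andP[] := F01 c. Qed.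

(** The shift exchanges [q] terms for [q] others, all in [0, 1]. *)
Lemma sum_shift_right (n q : nat) :
  \sum_(0 <= c < n) F c - q%:R <= \sum_(0 <= c < n) F (c + q)%N.
Proof.
have -> : \sum_(0 <= c < n) F (c + q)%N = \sum_(q <= c < n + q) F c.
  by rewrite -{2}[q]add0n big_addn addnK.
have e1 : \sum_(0 <= c < n + q) F c = \sum_(0 <= c < q) F c + \sum_(q <= c < n + q) F c.
  by rewrite -big_cat_nat// leq_addl.
have e2 : \sum_(0 <= c < n + q) F c = \sum_(0 <= c < n) F c + \sum_(n <= c < n + q) F c.
  by rewrite -big_cat_nat// leq_addr.
have := sum_ub 0 q; have := sum_ge0 n (n + q); rewrite subn0.
by lra.
Qed.

(** Truncated subtraction makes each of the first [q] terms equal to [F 0], which is at most 1. *)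
Lemma sum_shift_left (n q : nat) : (q <= n)%N ->
  \sum_(0 <= c < n) F (c - q)%N <= \sum_(0 <= c < n) F c + q%:R.
Proof.
move=> qn; rewrite (big_cat_nat (leq0n q) qn)/= addrC lerD//.
  rewrite -{1}[q]add0n big_addn.
  under eq_bigr do rewrite addnK.
  by rewrite [leRHS](big_cat_nat (leq0n _) (leq_subr q n))/= lerDl.
rewrite -[q in leRHS]subn0 -(@sumr_const_nat R q 0 1); apply: ler_sum => c _.
by have /andP[] := F01 (c - q)%N.
Qed.

End shifted_sums.

(** * Distribution function of the birth process at the sojourn time *)

Section birth_at_sojourn_time.
Context {R : realType} {d : measure_display} {Omega : measurableType d}.
Variables (P : probability Omega R) (lambda : nat -> R) (N : R -> {RV P >-> nat}).
Variables (t : R) (B : R -> {RV P >-> R}).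
Hypothesis lambda_gt0 : forall i : nat, (1 <= i)%N -> 0 < lambda i.
Hypothesis N_birth : pure_birth_process lambda N.
Hypothesis t_gt0 : 0 < t.
Hypothesis B_bridge : brownian_bridge t B.
Hypothesis NB_indep : independent_processes `[0, +oo[ N `[0, t] B.

Let F k (s : R) := birth_cdf N k s.
Let G w := sojourn_time t B w.

(** Monotonicity and right-continuity reduce the random time to rational ones: [N (G w) w <= k]
    exactly when [N q w <= k] for some rational [q > G w]. *)
Lemma measurable_birth_at_sojourn k : measurable [set w | (N (G w) w <= k)%N].
Proof.
rewrite (_ : [set _ | _] = \bigcup_(q : rat)
    ([set w | G w < ratr q] `&` [set w | (N (ratr q) w <= k)%N])).
  apply: bigcupT_measurable_rat => q; apply: measurableI.
    rewrite (_ : [set _ | _] = G @^-1` `]-oo, ratr q[).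
      rewrite -[X in measurable X]setTI.
      by apply: (measurable_sojourn_time t_gt0 B_bridge) => //; exact: measurable_itv.
    by apply/seteqP; split => w /=; rewrite in_itv.
  exact: (measurable_rv_nat _ [set i | (i <= k)%N]).
apply/seteqP; split => w /= => [Nk|[q _ [/= Gq Nq]]]; last first.
  apply: leq_trans Nq; apply: (birth_nondecreasing N_birth); last exact: ltW.
  exact: sojourn_time_ge0.
have := birth_right_continuous N_birth w (sojourn_time_ge0 t_gt0 B_bridge w).
rewrite near_withinE => /nbhs_ballP[r /= r0 hr].
have [q] := @rat_in_itvoo R (G w) (G w + r) (ltac:(by rewrite ltrDl)).
rewrite in_itv/= => /andP[Gq qr]; exists q => //; split => //=.
rewrite hr//; rewrite /ball/= distrC gtr0_norm ?subr_gt0//.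
by rewrite ltrBlDl.
Qed.

Lemma measurable_birth_at_count k n (phi : nat -> nat) :
  measurable [set w | (N (grid t n (phi (positive_count t B n w))) w <= k)%N].
Proof.
rewrite (_ : [set _ | _] = \bigcup_c ([set w | (N (grid t n (phi c)) w <= k)%N] `&`
    [set w | positive_count t B n w = c])).
  apply: bigcupT_measurable => c; apply: measurableI.
    exact: (measurable_rv_nat _ [set i | (i <= k)%N]).
  exact: measurable_positive_count.
apply/seteqP; split => w /= => [Nw|[c _ [/= + Cw]]]; last by rewrite Cw.
by exists (positive_count t B n w).
Qed.

(** Split on the value of the count: independence factors each term, and the count is uniform. *)
Lemma birth_at_count_law k n (phi : nat -> nat) :
  P [set w | (N (grid t n (phi (positive_count t B n w))) w <= k)%N] =
  ((\sum_(0 <= c < n.+1) F k (grid t n (phi c))) / n.+1%:R)%:E.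
Proof.
have mcount := measurable_positive_count t B n.
have gE c : [set w | (N (grid t n (phi (positive_count t B n w))) w <= k)%N] `&`
    [set w | positive_count t B n w = c] =
    [set w | (N (grid t n (phi c)) w <= k)%N] `&` [set w | positive_count t B n w = c].
  by apply/seteqP; split => w /= [Nw Cw]; split => //; [rewrite -Cw|rewrite Cw].
rewrite (@prob_split_nat _ _ _ P (positive_count t B n) _ n.+2) //; last 2 first.
- exact: measurable_birth_at_count.
- by move=> w _; rewrite ltnS; exact: positive_count_lt.
under eq_bigr => c _.
  rewrite gE NB_indep; last 2 first.
  - apply: (process_sigma_preimage (A := [set i | (i <= k)%N])) => //.
    by rewrite /= in_itv/= andbT grid_ge0.
  - exact: process_sigma_positive_count.
  rewrite (birth_cdfE N_birth) ?grid_ge0// (positive_count_law t_gt0 B_bridge) -EFinM.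
  over.
(* The value [n.+1] of the count has probability 0, leaving [n.+1] terms of equal weight. *)
rewrite sumEFin big_nat_recr//= ltnn mul0r mulr0 addr0; congr (_%:E).
rewrite mulr_suml big_nat [RHS]big_nat; apply: eq_bigr => c /andP[_ cn].
by rewrite cn mul1r.
Qed.

Lemma sojourn_time_bracket n q w : (`|count_error t B n w| < q%:R * t / n.+1%:R) ->
  grid t n (positive_count t B n w - q)%N <= G w <= grid t n (positive_count t B n w + q)%N.
Proof.
have bracket (x y z : R) : `|x - y| < z -> x - z <= y /\ y <= x + z.
  by rewrite ltr_norml => /andP[h1 h2]; split; lra.
move=> /bracket[h1 h2]; apply/andP; split; last by rewrite /grid natrD !mulrDl.
have [qC|Cq] := leqP q (positive_count t B n w).
  by rewrite /grid natrB// !mulrBl.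
(* When the count is below [q], truncated subtraction gives time 0, still a lower bound for the
   sojourn time. *)
rewrite (_ : (_ - q)%N = 0%N) /grid ?mul0r; last by apply/eqP; rewrite subn_eq0 ltnW.
exact: sojourn_time_ge0.
Qed.

(** Off the event [bad], the sojourn time lies between the grid times at the count minus [q] and
    plus [q], and monotone paths sandwich the event between [low] and [high]. The three errors come
    from the Riemann sum, the shift by [q], and [bad]. *)
Lemma birth_at_sojourn_approx k n q : (q <= n.+1)%N ->
  `|fine (P [set w | (N (G w) w <= k)%N]) -
    (birth_cdf_primitive lambda N k t - birth_cdf_primitive lambda N k 0) / t| <=
  n.+1%:R^-1 + q%:R / n.+1%:R +
    fine (P [set w | q%:R * t / n.+1%:R <= `|count_error t B n w|]).
Proof.
move=> qn; set p := fine _; set I := _ / t; set bad := [set w | _ <= _].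
have n0 : 0 < n.+1%:R :> R by rewrite ltr0n.
have mbad : measurable bad by exact: measurable_far_count_error.
have pE A : measurable A -> P A = (fine (P A))%:E.
  by move=> mA; rewrite fineK// fin_num_measure.
have mG := measurable_birth_at_sojourn k.
pose low := [set w | (N (grid t n (positive_count t B n w + q)%N) w <= k)%N].
pose high := [set w | (N (grid t n (positive_count t B n w - q)%N) w <= k)%N].
have F01 c : 0 <= F k (grid t n c) <= 1 by apply: (birth_cdf_bounds N_birth); exact: grid_ge0.
have S : `|(\sum_(0 <= c < n.+1) F k (grid t n c)) / n.+1%:R - I| <= n.+1%:R^-1.
  exact: (@riemann_sum_monotone R (F k) (birth_cdf_primitive lambda N k)
  (birth_cdf_primitive_is_derive lambda_gt0 N_birth k)
  (@birth_cdf_primitive_cvg0 _ _ _ _ _ _ N_birth k)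
  (birth_cdf_nonincreasing N_birth k) (birth_cdf_bounds N_birth k) t n.+1 t_gt0 isT).
have Plow := birth_at_count_law k n (fun c => c + q)%N; rewrite -/low in Plow.
have Phigh := birth_at_count_law k n (fun c => c - q)%N; rewrite -/high in Phigh.
have mlow : measurable low by exact: (measurable_birth_at_count k n (fun c => c + q)%N).
have mhigh : measurable high by exact: (measurable_birth_at_count k n (fun c => c - q)%N).
have sub1 : low `<=` [set w | (N (G w) w <= k)%N] `|` bad.
  move=> w Nw; have [wbad|wgood] := leP (q%:R * t / n.+1%:R) `|count_error t B n w|.
    by right.
  left; have /andP[_ Gle] := sojourn_time_bracket wgood.
  apply: leq_trans Nw; apply: (birth_nondecreasing N_birth) => //.
  exact: sojourn_time_ge0.
have sub2 : [set w | (N (G w) w <= k)%N] `<=` high `|` bad.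
  move=> w /= Nw; have [wbad|wgood] := leP (q%:R * t / n.+1%:R) `|count_error t B n w|.
    by right.
  left; have /andP[leG _] := sojourn_time_bracket wgood.
  apply: leq_trans Nw; apply: (birth_nondecreasing N_birth) => //.
  exact: grid_ge0.
have union_bound A C D : measurable A -> measurable C -> measurable D -> A `<=` C `|` D ->
    fine (P A) <= fine (P C) + fine (P D).
  move=> mA mC mD ACD; rewrite -lee_fin EFinD -!pE//.
  apply: (le_trans (le_measure P _ _ ACD)); rewrite ?inE//; first exact: measurableU.
  exact: measureU2.
have h1 := union_bound _ _ _ mlow mG mbad sub1.
have h2 := union_bound _ _ _ mG mhigh mbad sub2.
rewrite Plow Phigh /= -/p in h1 h2.
have s1 : (\sum_(0 <= c < n.+1) F k (grid t n c)) / n.+1%:R - q%:R / n.+1%:R <=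
    (\sum_(0 <= c < n.+1) F k (grid t n (c + q)%N)) / n.+1%:R.
  by rewrite -mulrBl ler_pM2r ?invr_gt0//; exact: sum_shift_right.
have s2 : (\sum_(0 <= c < n.+1) F k (grid t n (c - q)%N)) / n.+1%:R <=
    (\sum_(0 <= c < n.+1) F k (grid t n c)) / n.+1%:R + q%:R / n.+1%:R.
  by rewrite -mulrDl ler_pM2r ?invr_gt0//; exact: sum_shift_left.
move: S s1 s2 h1 h2; rewrite !ler_norml => /andP[].
move: (fine (P bad)) (n.+1%:R^-1) (q%:R / n.+1%:R) => b u v.
move: ((\sum_(0 <= c < n.+1) F k (grid t n c)) / n.+1%:R) => S0.
by move=> S1 S2 s1 s2 h1 h2; apply/andP; split; lra.
Qed.

Lemma birth_at_sojourn_cdf k :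
  P [set w | (N (G w) w <= k)%N] =
  ((birth_cdf_primitive lambda N k t - birth_cdf_primitive lambda N k 0) / t)%:E.
Proof.
have [->|k0] := posnP k.
  rewrite /birth_cdf_primitive !big_geq// subrr mul0r.
  apply: (eq_trans _ (measure0 P)); congr (P _); rewrite -subset0 => w /=.
  rewrite leqn0 => /eqP Nw; have := birth_ge1 N_birth w (sojourn_time_ge0 t_gt0 B_bridge w).
  by rewrite -/(G w) Nw.
rewrite -[LHS]fineK; last by rewrite fin_num_measure//; exact: measurable_birth_at_sojourn.
congr (_%:E); apply/eqP; rewrite -subr_eq0 -normr_le0.
set x := `|_|; apply/ler_addgt0Pl => e e0; rewrite addr0.
(* Each of the three error terms will be at most [1 / M], which is less than [e / 3]. *)
pose M := (Num.truncn (3 / e)).+1.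
have M3 : 3 / e < M%:R by exact: truncnS_gt.
have M0 : 0 < M%:R :> R by rewrite ltr0n.
have := positive_count_cvg_sojourn_time t_gt0 B_bridge (divr_gt0 t_gt0 M0).
move=> /fine_cvgP[_ /cvgrPdist_lt/(_ M%:R^-1)].
rewrite invr_gt0 => /(_ M0)[m _ hm].
(* With [n.+1 = M * m.+1] and [q = m.+1], the tolerance [q * t / n.+1] is the fixed [t / M] for
   which [m] was obtained, and [n >= m]. *)
pose n := (M * m.+1).-1; have nE : n.+1 = (M * m.+1)%N by rewrite prednK// muln_gt0.
have mn : (m <= n)%N by rewrite -ltnS nE leq_pmull.
have := hm n mn; rewrite /= sub0r normrN.
have qE : m.+1%:R * t / n.+1%:R = t / M%:R.
  rewrite nE natrM; have : m.+1%:R != 0 :> R by rewrite pnatr_eq0.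
  move: M0 (m.+1%:R : R) => + z; move: (M%:R : R) => y y0 z0.
  by field; rewrite z0 gt_eqF.
move=> /(le_lt_trans (ler_norm _)); rewrite -qE => bad.
have mM : (m.+1 <= n.+1)%N by rewrite nE leq_pmull.
apply: (le_trans (birth_at_sojourn_approx k mM)).
have -> : m.+1%:R / n.+1%:R = M%:R^-1 :> R.
  by rewrite nE natrM invfM mulrCA mulfV ?mulr1// pnatr_eq0.
have n1 : n.+1%:R^-1 <= M%:R^-1 :> R.
  by rewrite lef_pV2 ?posrE ?ltr0n// ler_nat nE leq_pmulr.
have M3' : 3 * M%:R^-1 <= e by rewrite ler_pdivrMr// mulrC -ler_pdivrMr// ltW.
apply: le_trans M3'; rewrite (_ : 3 * _ = M%:R^-1 + M%:R^-1 + M%:R^-1); last by ring.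
by apply: lerD; [exact: lerD|exact: ltW].
Qed.

End birth_at_sojourn_time.

Theorem theorem2p7 (R : realType) (d : measure_display)
    (Omega : measurableType d) (P : probability Omega R)
    (lambda : nat -> R) (N : R -> {RV P >-> nat})
    (t : R) (B : R -> {RV P >-> R}) (k : nat)
    (lambda_gt0 : forall i : nat, (1 <= i)%N -> 0 < lambda i)
    (lambda_distinct : forall i j : nat, (1 <= i)%N -> (1 <= j)%N ->
       i <> j -> lambda i <> lambda j)
    (no_explosion : (\sum_(1 <= i <oo) ((lambda i)^-1)%:E = +oo)%E)
    (N_birth : pure_birth_process lambda N)
    (t_gt0 : 0 < t)
    (B_bridge : brownian_bridge t B)
    (NB_indep : independent_processes `[0, +oo[ N `[0, t] B)
    (k_ge1 : (1 <= k)%N) :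
  P [set w | N (sojourn_time t B w) w = k] =
  (if (1 < k)%N then
     (lambda k * t)^-1 *
     (1 - \sum_(1 <= m < k.+1)
            (\prod_(1 <= l < k.+1 | l != m)
               (lambda l / (lambda l - lambda m))) *
            expR (- lambda m * t))
   else (1 - expR (- lambda 1%N * t)) / (lambda 1%N * t))%:E.
Proof.
(* Both branches of the statement are instances of this one expression. *)
transitivity ((lambda k * t)^-1 * (1 - hypoexp_tail lambda k t))%:E.
  case: k k_ge1 => // k _.
  rewrite -(birth_cdf_closed_form lambda_distinct N_birth) ?(ltW t_gt0)//.
  rewrite -(birth_cdf_primitive_increment lambda_gt0 N_birth)//.
  pose U j := [set w | (N (sojourn_time t B w) w <= j)%N].
  have mU j : measurable (U j) by exact: (measurable_birth_at_sojourn N_birth t_gt0 B_bridge j).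
  have UP j := birth_at_sojourn_cdf lambda_gt0 N_birth t_gt0 B_bridge NB_indep j.
  have UE : [set w | N (sojourn_time t B w) w = k.+1] = U k.+1 `\` U k.
    apply/seteqP; rewrite /U; split => w /=; first by move=> ->; rewrite ltnn.
    by move=> [h1 /negP h2]; apply/eqP; rewrite eqn_leq h1 ltnNge.
  have PU : P (U k.+1) = (P (U k) + P (U k.+1 `\` U k))%E.
    have Usub : U k `<=` U k.+1 by move=> w /=; exact: leqW.
    rewrite -[in LHS](setDUK Usub); apply: measureU => //; last exact: setDIK.
    exact: measurableD.
  rewrite UE; have fin A : measurable A -> P A \is a fin_num by exact: fin_num_measure.
  rewrite EFinB -!UP -/(U k.+1) -/(U k) PU addeAC subee ?add0e//; exact: fin.
case: k k_ge1 => [//|[|k]] _ //.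
(* For [k = 1] the product is empty and a single exponential remains. *)
rewrite /hypoexp_tail big_nat1 /hypoexp_coef big_mkcond big_nat1 eqxx mul1r/=.
by rewrite mulrC.
Qed.
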